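(* Let $G$ be a finite-horizon two-player ($I=\{1,2\}$) dynamic game with perfect information which is zero-sum or, more generally, fixed-sum (there is a constant $c\in\mathbb{R}$ with $u_1+u_2\equiv c$ on $H_\infty$). Suppose $f$ is a mixed-strategy subgame-perfect equilibrium of $G$ constructed by the improved backward induction algorithm. Then the set of all realizations of $f$ equals the set of all pure-strategy subgame-perfect equilibria of $G$. Equivalently, a pure-strategy profile $g$ is a subgame-perfect equilibrium of $G$ if and only if $g_{ti}(h_{t-1})\in \operatorname{support}(f_{ti}(\cdot|h_{t-1}))$ for all $t\ge1$, $i\in I$ and $h_{t-1}\in H_{t-1}$.
   Context: **Dynamic game with perfect information.** The set of active players is $I=\{1,\dots,n\}$; player $0$ is Nature and $I_0=I\cup\{0\}$. Stages are $t=0,1,2,\dots$. The set of starting points is $H_0=X_0\times S_0$, with $X_0$ a compact metric space and $S_0$ a Polish space. For $t\ge1$ let $X_{ti}$ ($i\in I$) and $S_t$ be Polish spaces, $X_t=\prod_{i\in I}X_{ti}$, $X^t=\prod_{0\le k\le t}X_k$, $S^t=\prod_{0\le k\le t}S_k$. The sets of histories $H_t\subseteq X^t\times S^t$ are defined recursively, together with the following data for $t\ge 1$: - for each $i\in I$, a continuous (upper and lower hemicontinuous), nonempty compact valued action correspondence $A_{ti}$ from $H_{t-1}$ to $X_{ti}$; put $A_t=\prod_{i\in I}A_{ti}$; - Nature's move $f_{t0}:H_{t-1}\to\mathcal{M}(S_t)$, continuous, where $\mathcal{M}(\cdot)$ denotes the set of Borel probability measures with the topology of weak convergence; - $H_t=\mathrm{Gr}(A_t)\times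 S_t$, where $\mathrm{Gr}(A_t)$ is the graph of $A_t$ (coordinates are reordered so that $H_t\subseteq X^t\times S^t$). Perfect information: at each stage $t\ge1$ there is only one mover, who may depend on the history $h_{t-1}$. That is, if $A_{ti}(h_{t-1})$ is not a single point for some $i\in I$ (player $i$ is the mover), then $A_{tj}(h_{t-1})$ is a single point for all $j\in I$, $j\ne i$, and $f_{t0}(h_{t-1})=\delta_{s_t}$ for some $s_t\in S_t$. If $f_{t0}(h_{t-1})$ is not a Dirac measure (Nature is the mover), then $A_{ti}(h_{t-1})$ is a single point for every $i\in I$. $H_\infty$ is the set of $(x,s)\in X^\infty\times S^\infty$ whose truncations satisfy $(x^t,s^t)\in H_t$ for all $t\ge0$, with the product topology. Each payoff function $u_i:H_\infty\to\mathbb{R}$ ($i\in I$) is bounded and continuous, and the game is continuous at infinity: $w^T\to0$ as $T\to\infty$, where $w^T=\sup|u_i(x,s)-u_i(\bar x,\bar s)|$ over all $i\in I$ and $(x,s),(\bar x,\bar s)\in H_\infty$ with $x^{T-1}=\bar x^{T-1}$, $s^{T-1}=\bar s^{T-1}$. The game is finite-horizon if there is a stage $T\ge1$ such that $A_{ti}$ is point-valued for every $i\in I$ and $t\ge T$. **Strategies.** A mixed strategy of player $i\in I$ is a sequence $f_i=\{f_{ti}\}_{t\ge1}$ of Borel measurable maps $f_{ti}:H_{t-1}\to\mathcal{M}(X_{ti})$ with $\operatorname{support}(f_{ti}(\cdot|h_{t-1}))\subseteq A_{ti}(h_{t-1})$ for all $h_{t-1}\in H_{t-1}$, where the support of a measure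 is the smallest closed set of measure $1$. It is a pure strategy if all $f_{ti}(\cdot|h_{t-1})$ are Dirac measures; a pure strategy $g_i$ is identified with the maps $g_{ti}:H_{t-1}\to X_{ti}$, $g_{ti}(h_{t-1})\in A_{ti}(h_{t-1})$. A strategy profile is $f=\{f_i\}_{i\in I}$. **Payoffs.** Given a profile $f$ and $h_t\in H_t$ ($t\ge0$), let $\tau_t=\delta_{h_t}$ and, for $t'\ge t$, $\tau_{t'+1}=\tau_{t'}\diamond(\otimes_{i\in I_0}f_{(t'+1)i})$, where $\lambda\diamond\nu(A\times B)=\int_A\nu(B|x)\,\lambda(dx)$. Let $\tau\in\mathcal{M}(H_\infty)$ be the unique measure with marginal $\tau_{t'}$ on $H_{t'}$ for all $t'\ge t$. Player $i$'s payoff from $f$ in the subgame beginning at $h_t$ is $u_i(f|h_t)=\int_{H_\infty}u_i\,d\tau$. If player $i$ is the mover at $h_{t-1}$ and $a\in A_{ti}(h_{t-1})$, then $u_i(f|h_{t-1},a)$ denotes player $i$'s payoff in the subgame beginning at $h_{t-1}$ when he plays $a$ at $h_{t-1}$ and all play thereafter follows $f$. **Subgame-perfect equilibrium.** A profile $f$ such that for all $i\in I$, $t\ge0$ and $h_t\in H_t$, player $i$ cannot improve his payoff in the subgame beginning at $h_t$ by a unilateral change of his (mixed) strategy. **Improved backward induction algorithm.** This is backward induction in which, whenever the mover has multiple optimal choices, he plays a mixed action whose support coincides with the set of optimal choices (rather than an arbitrary optimal choice). Thus a profile $f$ is constructed by this algorithm if, for every $t\ge1$ and every $h_{t-1}\in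 H_{t-1}$ at which a player $i\in I$ is the mover, $$\operatorname{support}(f_{ti}(\cdot|h_{t-1}))=\operatorname*{arg\,max}_{a\in A_{ti}(h_{t-1})}u_i(f|h_{t-1},a).$$ **Realization.** A realization of $f$ is a pure-strategy profile $g$ with $g_{ti}(h_{t-1})\in\operatorname{support}(f_{ti}(\cdot|h_{t-1}))$ for all $t\ge1$, $i\in I$, $h_{t-1}\in H_{t-1}$. *)

(* Defs.v *)
(** Dynamic games with perfect information and their subgame-perfect equilibria. *)
From HB Require Import structures.
From mathcomp Require Import all_boot all_order all_algebra.
From mathcomp Require Import all_classical all_reals all_analysis.

Set Implicit Arguments.
Unset Strict Implicit.
Unset Printing Implicit Defensive.
Import Order.TTheory GRing.Theory Num.Theory.
Import numFieldNormedType.Exports.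
Local Open Scope classical_set_scope.
Local Open Scope ring_scope.

(** ** Polish spaces and spaces of Borel probability measures *)

#[short(type="pmetricType")]
HB.structure Definition PointedMetric (R : numDomainType) :=
  {T of Metric R T & Pointed T}.

HB.mixin Record isSeparable T & Topological T := {
  separable : exists2 D : set T, countable D & dense D
}.

(** A Polish space comes with one of its compatible complete metrics; the
    notions below only depend on the topology. *)
#[short(type="polishType")]
HB.structure Definition Polish (R : numDomainType) :=
  {T of PointedMetric R T & Complete T & isSeparable T}.

HB.instance Definition _ (I : Type) (T : I -> ptopologicalType) :=
  isPointed.Build (prod_topology T) (fun=> point).

HB.instance Definition _ (T S : ptopologicalType) := Pointed.on (T * S)%type.

Notation borel T := (g_sigma_algebraType (@open T)).

Section borel_probabilities.
Context (R : realType) (T : ptopologicalType).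

Definition Mspace : Type := probability (borel T) R.

HB.instance Definition _ := Choice.on Mspace.
HB.instance Definition _ := Pointed.on Mspace.

Definition bounded_continuous : Type :=
  {phi : T -> R | continuous phi & exists M, forall x, `|phi x| <= M}.

(** The topology of weak convergence is the coarsest topology making
    [mu |-> \int phi dmu] continuous for every bounded continuous [phi]. *)
Definition weak_convergence_topology :=
  sup_topology (fun phi : bounded_continuous =>
    Topological.class (initial_topology
      (fun mu : Mspace => (\int[mu]_x s2val phi x)%R))).

HB.instance Definition _ := Topological.copy Mspace weak_convergence_topology.

Definition msupport (mu : Mspace) : set T :=
  \bigcap_(C in [set C : set T | closed C /\ mu C = 1%E]) C.

(** Equality with [\d_x] is only required on Borel sets: the values of a
    measure on the other sets are meaningless. *)
Definition is_dirac_at (mu : Mspace) (x : T) : Prop :=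
  forall B : set (borel T), measurable B -> mu B = \d_(x : borel T) B.

Definition is_dirac (mu : Mspace) : Prop := exists x, is_dirac_at mu x.

Definition mdirac (x : T) : Mspace := \d_(x : borel T).

End borel_probabilities.

(** ** Correspondences *)

Definition is_singleton (T : Type) (A : set T) : Prop := exists a, A = [set a].

Section correspondences.
Context (T U : topologicalType).
Implicit Types (D : set T) (A : T -> set U).

Definition upper_hemicontinuous D A : Prop :=
  forall x, D x -> forall O : set U, open O -> A x `<=` O ->
    \forall y \near within D (nbhs x), A y `<=` O.

Definition lower_hemicontinuous D A : Prop :=
  forall x, D x -> forall O : set U, open O -> A x `&` O !=set0 ->
    \forall y \near within D (nbhs x), A y `&` O !=set0.

End correspondences.

(** ** Histories

    Throughout, an index [t : nat] attached to a move ([Xs t i], [Ss t],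
    [action t i], [nature t], [f i t]) refers to stage [t + 1], where the
    history [h_t] in [hist t] is known.  Histories are stored as
    [((x_0, s_0), (x_1, s_1), ..., (x_t, s_t))], with [(x_k, s_k)] in
    [stage k]. *)

Record spaces (R : realType) (n : nat) := Spaces {
  X0 : pmetricType R;
  S0 : polishType R;
  Xs : nat -> 'I_n -> polishType R;
  Ss : nat -> polishType R
}.

Section histories.
Context (R : realType) (n : nat) (E : spaces R n).

Definition stage (k : nat) : ptopologicalType :=
  if k is t.+1 then (prod_topology (fun i => Xs E t i) * Ss E t)%type
  else (X0 E * S0 E)%type.

Fixpoint hist (t : nat) : ptopologicalType :=
  if t is t'.+1 then (hist t' * stage t'.+1)%type else stage 0.

Definition path : ptopologicalType := prod_topology stage.

Fixpoint trunc (t : nat) (z : path) : hist t :=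
  if t is t'.+1 then (trunc t' z, z t'.+1) else z 0%N.

End histories.

(** ** Games

    Correspondences, transitions, payoffs and strategies are total functions on
    the ambient spaces; only their values on [histories t] and [plays] matter. *)

Record game (R : realType) (n : nat) := Game {
  game_spaces :> spaces R n;
  action : forall (t : nat) (i : 'I_n),
    hist game_spaces t -> set (Xs game_spaces t i);
  nature : forall t : nat, hist game_spaces t -> Mspace R (Ss game_spaces t);
  utility : 'I_n -> path game_spaces -> R
}.

Arguments action {R n} g t i h.
Arguments nature {R n} g t h.
Arguments utility {R n} g i z.

Section games.
Context (R : realType) (n : nat) (G : game R n).

Fixpoint histories (t : nat) : set (hist G t) :=
  if t is t'.+1 then
    [set hz | @histories t' hz.1 /\ forall i, action G t' i hz.1 (hz.2.1 i)]
  else setT.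

Arguments histories : clear implicits.

Definition plays : set (path G) := [set z | forall t, histories t (trunc t z)].

(** [osc t] is the [w^T] of [T = t + 1]. *)
Definition osc (t : nat) : R :=
  sup [set v | exists (i : 'I_n) (z z' : path G),
    [/\ plays z, plays z', trunc t z = trunc t z' &
        v = `|utility G i z - utility G i z'|]].

Definition mover (t : nat) (h : hist G t) (i : 'I_n) : Prop :=
  ~ is_singleton (action G t i h).

Record perfect_information_game : Prop := {
  compact_X0 : compact [set: X0 G];
  action_nonempty : forall t i h, histories t h -> action G t i h !=set0;
  action_compact : forall t i h, histories t h -> compact (action G t i h);
  action_upper : forall t i, upper_hemicontinuous (histories t) (action G t i);
  action_lower : forall t i, lower_hemicontinuous (histories t) (action G t i);
  nature_continuous : forall t, {within histories t, continuous (nature G t)};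
  single_player_moves : forall t (h : hist G t) i, histories t h -> mover h i ->
    (forall j, j != i -> is_singleton (action G t j h)) /\
    is_dirac (nature G t h);
  single_nature_moves : forall t (h : hist G t), histories t h ->
    ~ is_dirac (nature G t h) -> forall i, is_singleton (action G t i h);
  utility_continuous : forall i, {within plays, continuous (utility G i)};
  utility_bounded : exists M, forall i z, plays z -> `|utility G i z| <= M;
  continuous_at_infinity : osc @ \oo --> (0 : R)
}.

Definition finite_horizon : Prop :=
  exists T : nat, forall t i h, (T <= t)%N -> histories t h ->
    is_singleton (action G t i h).

(** ** Strategies *)

Definition strategy (i : 'I_n) : Type :=
  forall t : nat, hist G t -> Mspace R (Xs G t i).

Definition profile : Type := forall i : 'I_n, strategy i.

(** Borel measurability refers to the Borel sets of the topology of weak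
    convergence. *)
Definition is_strategy (i : 'I_n) (fi : strategy i) : Prop :=
  forall t,
    measurable_fun (histories t : set (borel (hist G t)))
      (fi t : borel (hist G t) -> borel (Mspace R (Xs G t i))) /\
    forall h, histories t h -> msupport (fi t h) `<=` action G t i h.

Definition is_profile (f : profile) : Prop := forall i, is_strategy (f i).

Definition pure_profile : Type :=
  forall (i : 'I_n) (t : nat), hist G t -> Xs G t i.

Definition mixed_of_pure (g : pure_profile) : profile :=
  fun i t h => mdirac R (g i t h).

(** As the support of [\d_a] is [[set a]], this includes [g i t h] being in
    [action G t i h]. *)
Definition is_pure_profile (g : pure_profile) : Prop :=
  is_profile (mixed_of_pure g).

(** ** Payoffs *)

(** [mu] is the composition of the law [lam] on [histories t] with the product
    of the moves of all players and of Nature; it is characterized by its values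
    on measurable rectangles. *)
Definition is_diamond (f : profile) (t : nat)
    (lam : Mspace R (hist G t)) (mu : Mspace R (hist G t.+1)) : Prop :=
  forall (A : set (borel (hist G t))) (B : forall i, set (borel (Xs G t i)))
      (C : set (borel (Ss G t))),
    measurable A -> A `<=` histories t -> (forall i, measurable (B i)) ->
    measurable C ->
    mu [set hz | [/\ A hz.1, forall i, B i (hz.2.1 i) & C hz.2.2]] =
    (\int[lam]_(h in A)
       ((\big[*%E/1%E]_(i < n) f i t h (B i)) * nature G t h C))%E.

Definition is_outcome (f : profile) (t : nat) (h : hist G t)
    (tau : Mspace R (path G)) : Prop :=
  tau plays = 1%E /\
  exists tau_ : forall k, Mspace R (hist G k),
    [/\ is_dirac_at (tau_ t) h,
        forall k, (t <= k)%N -> is_diamond f (tau_ k) (tau_ k.+1) &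
        forall k, (t <= k)%N -> forall B : set (borel (hist G k)),
          measurable B -> tau (trunc k @^-1` B) = tau_ k B].

(** The unique law on [plays] of the play from [h] on ([get] is classical
    choice). *)
Definition outcome (f : profile) (t : nat) (h : hist G t) : Mspace R (path G) :=
  get (is_outcome f h).

Definition payoff (i : 'I_n) (f : profile) (t : nat) (h : hist G t) : R :=
  (\int[outcome f h]_(z in plays) utility G i z)%R.

(** Player [i] plays [a] at [h], and [f] is followed everywhere else. *)
Definition play_at (f : profile) (t : nat) (h : hist G t) (i : 'I_n)
    (a : Xs G t i) : profile :=
  dfwith f i
    (dfwith (f i) t (fun h' => if h' == h then mdirac R a else f i t h')).
Arguments play_at f {t} h i a.

(** ** Equilibria *)

Definition is_spe (f : profile) : Prop :=
  is_profile f /\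
  forall (i : 'I_n) (t : nat) (h : hist G t), histories t h ->
    forall fi' : strategy i, is_strategy fi' ->
      payoff i (dfwith f i fi') h <= payoff i f h.

Definition is_pure_spe (g : pure_profile) : Prop :=
  is_pure_profile g /\ is_spe (mixed_of_pure g).

Definition optimal_choices (f : profile) (t : nat) (h : hist G t) (i : 'I_n) :
    set (Xs G t i) :=
  [set a | action G t i h a /\ forall b, action G t i h b ->
     payoff i (play_at f h i b) h <= payoff i (play_at f h i a) h].

Arguments optimal_choices f {t} h i.

Definition improved_backward_induction (f : profile) : Prop :=
  forall (t : nat) (h : hist G t) (i : 'I_n), histories t h -> mover h i ->
    msupport (f i t h) = optimal_choices f h i.

Definition is_realization (f : profile) (g : pure_profile) : Prop :=
  is_pure_profile g /\
  forall (i : 'I_n) (t : nat) (h : hist G t), histories t h ->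
    msupport (f i t h) (g i t h).

End games.

Arguments histories {R n} G t.
Arguments plays {R n} G.

Definition fixed_sum (R : realType) (G : game R 2) : Prop :=
  exists c : R, forall z, plays G z ->
    utility G ord0 z + utility G ord_max z = c.

(* Main.v *)
(** Nature's moves and the players' mixed actions define a Markov kernel from
    histories to next-stage histories, and the law of play from a history is its
    Ionescu-Tulcea extension. Hence the payoff at [h] is the integral of the
    payoffs at the successors of [h] against the moves made at [h].

    In a fixed-sum game all equilibria give the same payoffs in every subgame.
    If a pure profile [g] is an equilibrium, playing [g i t h] at a node of [i]
    and following [f] afterwards thus gives [i] the value of the subgame, so that
    [g i t h] is an optimal choice. Conversely let [g] realize [f]. Backward
    induction shows that a player [i] deviating from [g] gets at most the value:
    at a node of [i] this is the equilibrium property of [f]; at a node of the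
    other player, [g] makes an optimal choice against [f], which leaves that
    player at least, hence [i] at most, the value. *)
From HB Require Import structures.
Require Import Defs.
From mathcomp Require Import all_boot all_order all_algebra.
From mathcomp Require Import all_classical all_reals all_analysis.
From mathcomp Require Import measurable_realfun giry.

Set Implicit Arguments.
Unset Strict Implicit.
Unset Printing Implicit Defensive.
Import Order.TTheory GRing.Theory Num.Theory.
Import numFieldNormedType.Exports.

Local Open Scope classical_set_scope.
Local Open Scope ring_scope.

(** * Borel sets of the history spaces *)

(** [payoff] refers to a law chosen among those satisfying [is_outcome], so nothing can be computed
    before such a law is shown to exist and to be unique. [is_diamond] fixes it on rectangles only;
    countable bases are what makes rectangles generate the Borel sets of a product. Equilibria share
    their values by an exchange argument. If [f] and [g] are equilibria, consider the hybrid in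
    which [i] plays as in [f] and the opponent as in [g]. It is a deviation of the opponent from
    [f], so it gives [i] at least his payoff under [f]; it is a deviation of [i] from [g], so it
    gives [i] at most his payoff under [g]. Hence nobody gets more from [f] than from [g], and a
    constant sum leaves only equality. Plays stay infinite past the horizon, where Nature may still
    move. Backward induction therefore starts not from terminal payoffs but from the fact that, once
    all action sets are singletons, all profiles make the same moves and so have the same
    payoffs. *)

Definition nbhs_base (T : topologicalType) (I : Type) (b : I -> set T) : Prop :=
  (forall i, open (b i)) /\
  forall x V, nbhs x V -> exists2 i, b i x & b i `<=` V.

Definition nat_based (T : topologicalType) : Prop :=
  exists b : nat -> set T, nbhs_base b.

Lemma nbhs_base_nat_based (T : topologicalType) (I : countType) (b : I -> set T) :
  nbhs_base b -> nat_based T.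
Proof.
move=> [ob bb]; exists (fun n => if unpickle n is Some i then b i else set0).
split=> [n|x V /bb[i bix biV]]; first by case: unpickle => // *; exact: open0.
by exists (pickle i); rewrite pickleK.
Qed.

Lemma second_countable_nat_based (T : topologicalType) :
  @second_countable T -> nat_based T.
Proof.
move=> [B cB [oB bB]].
have [B0|[g]] : B = set0 \/ $|{surjfun [set: nat] >-> B}| by exact/pfcard_geP.
  exists (fun=> set0); split=> [_|x V /bB[U [] ]]; first exact: open0.
  by rewrite B0.
exists g; split=> [n|x V /bB[U [BU Ux] UV]]; first by apply: oB; exact: funS.
by have [n _ gn] := @surj _ _ _ _ g U BU; exists n; rewrite gn.
Qed.

(** An open set is the union of the basic sets it contains. Countability of the index type, through
    [unpickle], makes this a union over [nat], which a sigma-algebra tolerates. *)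
Lemma nbhs_base_sigma (T : topologicalType) (I : countType) (b : I -> set T)
    (G : set (set T)) :
  (forall x V, nbhs x V -> exists2 i, b i x & b i `<=` V) ->
  (forall i, <<s G >> (b i)) -> @open T `<=` <<s G >>.
Proof.
move=> bb bG O oO.
pose F n := if @unpickle I n is Some i then
  (if `[< b i `<=` O >] then b i else set0) else set0.
have -> : O = \bigcup_n F n.
  apply/seteqP; split=> [x Ox|x [n _]]; last first.
    by rewrite /F; case: unpickle => // i; case: asboolP => // bO /bO.
  have [i bix biO] := bb x O (open_nbhs_nbhs (conj oO Ox)).
  by exists (pickle i) => //; rewrite /F pickleK; case: asboolP.
apply: sigma_algebra_bigcup => n; rewrite /F.
case: unpickle => [i|]; last exact: sigma_algebra0.
by case: asboolP => // _; exact: sigma_algebra0.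
Qed.

Lemma borel_continuous (T U : ptopologicalType) (f : T -> U) :
  continuous f -> measurable_fun setT (f : borel T -> borel U).
Proof.
move=> cf; apply: (@measurability _ _ (borel T) (borel U) setT f (@open U)) => // _ [W oW <-].
by apply: sub_sigma_algebra; rewrite setTI; apply: open_comp => // x _; exact: cf.
Qed.

Lemma borel_open (T : ptopologicalType) (O : set T) : open O ->
  measurable (O : set (borel T)).
Proof. exact: sub_sigma_algebra. Qed.

Lemma borel_closed (T : ptopologicalType) (O : set T) : closed O ->
  measurable (O : set (borel T)).
Proof.
by move=> cO; rewrite -(setCK O); apply: measurableC; apply: borel_open;
  exact: closed_openC.
Qed.

Section metric_base.
Context (R : realType).

Lemma separable_nat_based (T : polishType R) : nat_based T.
Proof.
have [D cD dD] := @separable _ T.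
have [D0|[g]] : D = set0 \/ $|{surjfun [set: nat] >-> D}| by exact/pfcard_geP.
  (* A dense set is nonempty because the space is pointed. *)
  by have := dD setT (ex_intro _ point I) openT; rewrite D0 setI0 => -[].
apply: (@nbhs_base_nat_based _ (nat * nat)%type
  (fun nm => interior (ball (g nm.1) nm.2.+1%:R^-1))); split=> [i|x V].
  exact: open_interior.
move/nbhs_ballP => [e /= e0 eV].
have [n ne] := ltr_add_invr (divr_gt0 e0 (ltr0Sn R 1)).
rewrite add0r in ne.
have n0 : 0 < n.+1%:R^-1 :> R by rewrite invr_gt0 ltr0Sn.
(* Half of the radius [n.+1%:R^-1] is spent on reaching a point [y] of [D], so that [x] is interior
   to the ball of the full radius around [y]; as that radius is below [e / 2], this ball stays
   within [e] of [x]. *)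
have [|y [yb yD]] := dD (interior (ball x (n.+1%:R^-1 / 2))) _ (@open_interior _ _).
  by exists x; apply: nbhsx_ballx; rewrite divr_gt0.
have [m _ gm] := @surj _ _ _ _ g y yD.
have xy := interior_subset yb.
exists (m, n) => /=; rewrite gm.
  apply/nbhs_ballP; exists (n.+1%:R^-1 / 2); rewrite /= ?divr_gt0// => z xz.
  by rewrite [n.+1%:R^-1]splitr; apply: ball_triangle xz; exact: ball_sym.
move=> z /interior_subset yz; apply: eV; rewrite (splitr e).
apply: (@ball_triangle _ _ y); last exact: (le_ball (ltW ne)) yz.
apply: le_ball xy; rewrite (le_trans _ (ltW ne))//.
by apply: ler_piMr; [exact: ltW|rewrite invf_le1 ?ler1n].
Qed.

Lemma compact_nat_based (T : pmetricType R) : compact [set: T] -> nat_based T.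
Proof.
by move=> cT; apply/second_countable_nat_based/compact_second_countable.
Qed.
End metric_base.

Lemma nat_based_prod (T U : topologicalType) :
  nat_based T -> nat_based U -> nat_based (T * U)%type.
Proof.
move=> [b [ob bb]] [c [oc cc]].
apply: (@nbhs_base_nat_based _ (nat * nat)%type (fun nm => b nm.1 `*` c nm.2)).
split=> [i|[x y] V [[A B] [/= Ax By] ABV]].
  have -> : b i.1 `*` c i.2 = (fst @^-1` b i.1) `&` (snd @^-1` c i.2) by [].
  by apply: openI; apply: open_comp => // z _; [exact: cvg_fst|exact: cvg_snd].
have [n bnx bnA] := bb _ _ Ax; have [m cmy cmB] := cc _ _ By.
by exists (n, m) => //= -[u v] [/= /bnA ? /cmB ?]; exact: ABV.
Qed.

(** The sets containing a box around [x] form a filter that converges to [x] for each initial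
    topology of a projection, hence for their supremum. The boxes may constrain all coordinates;
    they are open when [I] is finite, the case in which they are turned into a base. *)
Lemma prod_topology_nbhs (I : Type) (T : I -> topologicalType)
    (x : prod_topology T) (V : set (prod_topology T)) : nbhs x V ->
  exists2 U : forall i, set (T i), (forall i, nbhs (x i) (U i)) &
    forall y, (forall i, U i (y i)) -> V y.
Proof.
pose F : set_system (prod_topology T) := [set V |
  exists2 U : forall i, set (T i), (forall i, nbhs (x i) (U i)) &
    forall y, (forall i, U i (y i)) -> V y].
have FF : Filter F.
  split=> [|A B [U xU UA] [W xW WB]|A B AB [U xU UA]].
  - by exists (fun=> setT) => // i; exact: filterT.
  - exists (fun i => U i `&` W i) => [i|y yUW]; first exact: filterI.
    by split; [apply: UA|apply: WB] => i; case: (yUW i).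
  - by exists U => // y /UA /AB.
suff : F --> (x : prod_topology T) by exact.
apply/cvg_sup => i A; rewrite /= (@nbhsE (initial_topology _)).
move=> [B [[W oW <-] /= Oxi] OA].
(* [W] lives in [T i], so it is transported along [j = i]; the other coordinates are
   unconstrained. *)
exists (fun j => [set u : T j | forall e : j = i, W (ecast k (T k) e u)]) => [j|y yU].
  have [ji|ji] := pselect (j = i); last first.
    by apply: filterS filterT => u _ e.
  subst j; apply: filterS (open_nbhs_nbhs (conj oW Oxi)) => u Ou e.
  by rewrite (Prop_irrelevance e erefl).
by apply: OA; have := yU i erefl.
Qed.

Lemma prod_topology_open (I : finType) (T : I -> topologicalType)
    (U : forall i, set (T i)) : (forall i, open (U i)) ->
  open [set x : prod_topology T | forall i, U i (x i)].
Proof.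
move=> oU; have -> : [set x : prod_topology T | forall i, U i (x i)] =
    \big[setI/setT]_(i : I) (proj i @^-1` U i).
  apply/seteqP; split=> [x xU|x].
    by elim/big_ind: _ => [//|A B Ax Bx|i _]; [split|exact: xU].
  by move=> /= + i; rewrite (bigD1 i)//= => -[].
elim/big_ind: _ => [|A B|i _]; [exact: openT|exact: openI|].
by apply: open_comp => // x _; exact: proj_continuous.
Qed.

Lemma prod_topology_base (I : finType) (T : I -> topologicalType)
    (b : forall i, nat -> set (T i)) : (forall i, nbhs_base (b i)) ->
  nbhs_base (fun f : {ffun I -> nat} =>
    [set x : prod_topology T | forall i, b i (f i) (x i)]).
Proof.
move=> bb; split=> [f|x V /prod_topology_nbhs[U xU UV]].
  by apply: (@prod_topology_open I T (fun i => b i (f i))) => i; have [] := bb i.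
have /choice[f fP] i : exists n, b i n (x i) /\ b i n `<=` U i.
  by have [n ? ?] := (bb i).2 _ _ (xU i); exists n.
exists (finfun f) => /= [i|y yb]; first by rewrite ffunE; exact: (fP i).1.
by apply: UV => i; apply: (fP i).2; have := yb i; rewrite ffunE.
Qed.

Lemma prod_topology_continuous (I : Type) (S : topologicalType)
    (T : I -> topologicalType) (f : S -> prod_topology T) :
  (forall i, continuous (fun s => f s i)) -> continuous f.
Proof.
move=> cf x; apply/cvg_sup => i A; rewrite /= (@nbhsE (initial_topology _)).
move=> [B [[W oW <-] /= Oxi] OA].
have := cf i x _ (open_nbhs_nbhs (conj oW Oxi)).
exact: (@filterS _ (nbhs x) _ _ _ (fun y : S => OA (f y))).
Qed.

Lemma continuous_pair (S T U : topologicalType) (f : S -> T) (g : S -> U) :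
  continuous f -> continuous g -> continuous (fun s => (f s, g s)).
Proof.
move=> cf cg s A [[B C] [/= fB gC] BCA].
have fS : nbhs s (f @^-1` B) := cf s _ fB.
have gS : nbhs s (g @^-1` C) := cg s _ gC.
exact: (@filterS _ (nbhs s) _ _ _ (fun y (BC : B (f y) /\ C (g y)) => BCA (f y, g y) BC) (filterI fS gS)).
Qed.

Section history_spaces.
Context (R : realType) (n : nat) (E : spaces R n).
Hypothesis cX0 : compact [set: X0 E].

Lemma nat_based_stage k : nat_based (stage E k).
Proof.
case: k => [|k] /=.
  by apply: nat_based_prod; [exact: compact_nat_based|exact: separable_nat_based].
apply: nat_based_prod; last exact: separable_nat_based.
pose b i := projT1 (cid (separable_nat_based (Xs E k i))).
have bP i : nbhs_base (b i) := projT2 (cid (separable_nat_based (Xs E k i))).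
by apply: nbhs_base_nat_based (prod_topology_base bP).
Qed.

Lemma nat_based_hist t : nat_based (hist E t).
Proof.
elim: t => [|t IH]; first exact: (nat_based_stage 0).
exact: nat_based_prod IH (nat_based_stage t.+1).
Qed.

Lemma hausdorff_prod (T U : topologicalType) :
  hausdorff_space T -> hausdorff_space U -> hausdorff_space (T * U)%type.
Proof.
move=> hT hU [x y] [x' y'] xy; congr pair.
  apply: hT => A B xA xB.
  have [||[z w] [[/= Az _] [Bz _]]] := xy (A `*` setT) (B `*` setT).
  - by exists (A, setT) => //; split => //; exact: filterT.
  - by exists (B, setT) => //; split => //; exact: filterT.
  by exists z.
apply: hU => A B xA xB.
have [||[z w] [[/= _ Aw] [_ Bw]]] := xy (setT `*` A) (setT `*` B).
- by exists (setT, A) => //; split => //; exact: filterT.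
- by exists (setT, B) => //; split => //; exact: filterT.
by exists w.
Qed.

Lemma hausdorff_hist t : hausdorff_space (hist E t).
Proof.
elim: t => [|t IH]; first by apply: hausdorff_prod; exact: metric_hausdorff.
apply: hausdorff_prod => //; apply: hausdorff_prod; last exact: metric_hausdorff.
by apply: hausdorff_product => i; exact: metric_hausdorff.
Qed.

Lemma closed_hist1 t (h : hist E t) : closed [set h].
Proof. exact/accessible_closed_set1/hausdorff_accessible/hausdorff_hist. Qed.

Lemma trunc_continuous t : continuous (@trunc R n E t).
Proof.
elim: t => [|t IH]; first exact: (@proj_continuous _ (stage E) 0%N).
exact: (continuous_pair IH (@proj_continuous _ (stage E) t.+1)).
Qed.

Lemma eq_trunc t (z z' : Defs.path E) :
  (forall k, (k <= t)%N -> z k = z' k) -> trunc t z = trunc t z'.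
Proof.
elim: t => [|t IH] zz'; first exact: zz'.
by congr pair; [apply: IH => k kt; apply: zz'; exact: leqW|exact: zz'].
Qed.

(* Completes a history to a path by junk coordinates [point]. *)
Fixpoint ext t : hist E t -> Defs.path E :=
  if t is t'.+1 then fun hz => dfwith (ext hz.1) t'.+1 hz.2
  else fun z => dfwith (point : Defs.path E) 0%N z.

Lemma trunc_ext t : cancel (@ext t) (@trunc R n E t).
Proof.
elim: t => [|t IH] h; first by rewrite /= dfwithin.
case: h => h z; congr pair; last exact: dfwithin.
rewrite -[RHS]IH; apply: eq_trunc => k kt /=; rewrite dfwithout//.
by apply/eqP => tk; rewrite -tk ltnn in kt.
Qed.

Lemma dfwith_continuous2 (S : topologicalType) (g : S -> Defs.path E) k (u : S -> stage E k) :
  continuous g -> continuous u -> continuous (fun s => dfwith (g s) k (u s) : Defs.path E).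
Proof.
move=> cg cu; apply: (@prod_topology_continuous _ _ (stage E)) => j.
have [kj|kj] := eqVneq k j.
  by subst j; under [X in continuous X]eq_fun do rewrite dfwithin.
under [X in continuous X]eq_fun do rewrite dfwithout//.
move=> s V gV; exact: (cg s _ (@proj_continuous _ (stage E) j (g s) _ gV)).
Qed.

Lemma ext_continuous t : continuous (@ext t).
Proof.
elim: t => [|t IH].
  apply: (@dfwith_continuous2 (stage E 0) (fun=> point) 0%N id).
    by move=> ?; exact: cvg_cst.
  by move=> ?; exact: cvg_id.
apply: (@dfwith_continuous2 (hist E t.+1) (fun hz => ext hz.1) t.+1 snd).
  move=> s; apply: (@continuous_comp _ _ _ (fst : hist E t.+1 -> _) (@ext t)).
    exact: cvg_fst.
  exact: IH.
by move=> s; exact: cvg_snd.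
Qed.

(** Same filter argument as for boxes, with truncations: a neighbourhood in the infinite product
    depends on finitely many stages, hence contains the preimage of a neighbourhood of one
    truncation. *)
Lemma path_nbhs (z : Defs.path E) V : nbhs z V ->
  exists k, exists2 W, nbhs (trunc k z) W & trunc k @^-1` W `<=` V.
Proof.
pose F : set_system (Defs.path E) := [set V |
  exists k, exists2 W, nbhs (trunc k z) W & trunc k @^-1` W `<=` V].
(* Raising the level makes the family directed, which closure under intersection requires. *)
have Fmono k V' : (exists2 W, nbhs (trunc k z) W & trunc k @^-1` W `<=` V') ->
    forall j, (k <= j)%N ->
    exists2 W, nbhs (trunc j z) W & trunc j @^-1` W `<=` V'.
  move=> kW; elim => [|j IH]; first by rewrite leqn0 => /eqP<-.
  rewrite leq_eqVlt => /predU1P[<-//|/IH[W' zW' W'V]].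
  exists (fst @^-1` W') => /=; last by move=> y; exact: W'V.
  exact: (@cvg_fst _ _ (nbhs (trunc j z)) (nbhs (z j.+1)) _ _ zW').
have FF : Filter F.
  split=> [|A B [k kA] [j jB]|A B AB [k [W kW WA]]].
  - by exists 0%N, setT => //; exact: filterT.
  - have [W kW WA] := Fmono _ _ kA _ (leq_maxl k j).
    have [U kU UB] := Fmono _ _ jB _ (leq_maxr k j).
    by exists (maxn k j), (W `&` U); [exact: filterI|move=> y [/WA ? /UB]].
  - by exists k, W => // y /WA /AB.
suff : F --> (z : Defs.path E) by exact.
apply/cvg_sup => i A; rewrite /= (@nbhsE (initial_topology _)).
move=> [B [[W oW <-] /= Wzi] WA].
move: i {B} A W oW Wzi WA => [|i] A W oW Wzi WA; [exists 0%N|exists i.+1].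
  by exists W => //; exact: open_nbhs_nbhs.
exists (snd @^-1` W) => /=; last by move=> y; exact: WA.
exact: (@cvg_snd _ _ (nbhs (trunc i z)) (nbhs (z i.+1)) _ _ (open_nbhs_nbhs (conj oW Wzi))).
Qed.

Definition cylinder : set (set (Defs.path E)) :=
  [set C | exists k, exists2 B : set (borel (hist E k)), measurable B &
     C = trunc k @^-1` B].

(** Countable bases of all the spaces [hist E k] pull back to one countable base of the path space,
    indexed by the level and the basic set, and made of cylinders. *)
Lemma borel_cylinder : @measurable _ (borel (Defs.path E)) = <<s cylinder >>.
Proof.
apply/seteqP; split; last first.
  apply: smallest_sub; first exact: sigma_algebra_measurable.
  move=> _ [k [B mB ->]].
  by have := borel_continuous (@trunc_continuous k) measurableT mB; rewrite setTI.
pose b k := projT1 (cid (nat_based_hist k)).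
have bP k : nbhs_base (b k) := projT2 (cid (nat_based_hist k)).
apply: smallest_sub; first exact: smallest_sigma_algebra.
pose c (km : nat * nat) := trunc km.1 @^-1` b km.1 km.2.
apply: (@nbhs_base_sigma _ _ c); last first.
  move=> [k m]; apply: sub_sigma_algebra; exists k, (b k m) => //.
  by apply: borel_open; exact: (bP k).1.
move=> z V /path_nbhs[k [W zW WV]].
by have [m bm mW] := (bP k).2 _ _ zW; exists (k, m) => // y /mW; exact: WV.
Qed.

Definition rectangle t : set (set (hist E t.+1)) := [set D |
  exists (A : set (borel (hist E t))) (B : forall i, set (borel (Xs E t i)))
         (C : set (borel (Ss E t))),
  [/\ measurable A, forall i, measurable (B i), measurable C &
      D = [set hz | [/\ A hz.1, forall i, B i (hz.2.1 i) & C hz.2.2]]]].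

Lemma rectangleI t : setI_closed (@rectangle t).
Proof.
move=> _ _ [A [B [C [mA mB mC ->]]]] [A' [B' [C' [mA' mB' mC' ->]]]].
exists (A `&` A'), (fun i => B i `&` B' i), (C `&` C'); split.
- exact: measurableI.
- by move=> i; exact: measurableI.
- exact: measurableI.
apply/seteqP; split=> [h [[? BB ?] [? BB' ?]]|h [[? ?] BB [? ?]]].
  by split.
by split; split=> // i; have [] := BB i.
Qed.

Lemma hz1_continuous t : continuous (fun hz : hist E t.+1 => hz.1).
Proof. by move=> s; exact: cvg_fst. Qed.

Lemma hz21_continuous t i : continuous (fun hz : hist E t.+1 => hz.2.1 i).
Proof.
move=> s; apply: (@continuous_comp _ _ _ (fun hz : hist E t.+1 => hz.2.1) (proj i)).
  apply: (@continuous_comp _ _ _ snd fst); [exact: cvg_snd|exact: cvg_fst].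
exact: proj_continuous.
Qed.

Lemma hz22_continuous t : continuous (fun hz : hist E t.+1 => hz.2.2).
Proof.
by move=> s; apply: (@continuous_comp _ _ _ snd snd); exact: cvg_snd.
Qed.

Lemma measurable_rectangle t D : rectangle D ->
  measurable (D : set (borel (hist E t.+1))).
Proof.
move=> [A [B [C [mA mB mC ->]]]].
have m1 := borel_continuous (@hz1_continuous t) measurableT mA.
have m2 i := borel_continuous (@hz21_continuous t i) measurableT (mB i).
have m3 := borel_continuous (@hz22_continuous t) measurableT mC.
rewrite setTI in m1; rewrite setTI in m3.
have m2' : measurable (\bigcap_(i in [set: 'I_n])
    [set hz : borel (hist E t.+1) | B i (hz.2.1 i)]).
  apply: fin_bigcap_measurable => // i _.
  by have := m2 i; rewrite setTI.
have := measurableI _ _ m1 (measurableI _ _ m2' m3).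
rewrite (_ : _ `&` _ = [set hz : borel (hist E t.+1) |
  [/\ A hz.1, forall i, B i (hz.2.1 i) & C hz.2.2]])//.
apply/seteqP; split=> [h [/= ? [BB ?]]|h [/= ? BB ?]].
  by split=> // i; exact: BB.
by split => //; split => // i _; exact: BB.
Qed.

(** This makes a law on [hist E t.+1] determined by the values that [is_diamond] prescribes.
    Products of basic open sets form a countable base consisting of rectangles. *)
Lemma borel_rectangle t : @measurable _ (borel (hist E t.+1)) = <<s @rectangle t >>.
Proof.
apply/seteqP; split; last first.
  apply: smallest_sub; first exact: sigma_algebra_measurable.
  by move=> D; exact: measurable_rectangle.
have [a aP] := nat_based_hist t.
pose b i := projT1 (cid (separable_nat_based (Xs E t i))).
have bP i : nbhs_base (b i) := projT2 (cid (separable_nat_based (Xs E t i))).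
have [s sP] : nat_based (Ss E t) by exact: separable_nat_based.
apply: smallest_sub; first exact: smallest_sigma_algebra.
pose c (kfm : nat * {ffun 'I_n -> nat} * nat) := [set hz : hist E t.+1 |
  [/\ a kfm.1.1 hz.1, forall i, b i (kfm.1.2 i) (hz.2.1 i) & s kfm.2 hz.2.2]].
have cR kfm : rectangle (c kfm).
  exists (a kfm.1.1), (fun i => b i (kfm.1.2 i)), (s kfm.2); split => //.
  - by apply: borel_open; exact: aP.1.
  - by move=> i; apply: borel_open; exact: (bP i).1.
  - by apply: borel_open; exact: sP.1.
have bc x V : nbhs x V -> exists2 i, c i x & c i `<=` V.
  case: x => [h [x y]] [[A B] [/= hA [[C D] [/= xC yD] CDB]] ABV].
  have [k ak kA] := aP.2 _ _ hA.
  have [f bf fC] := (prod_topology_base bP).2 _ _ xC.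
  have [m sm mD] := sP.2 _ _ yD.
  exists (k, f, m); first by split.
  move=> [h' [x' y']] [/= ? ? ?]; apply: (ABV (h', (x', y'))).
  by split; [exact: kA|apply: (CDB (x', y')); split; [exact: fC|exact: mD]].
apply: (nbhs_base_sigma bc) => kfm.
exact: sub_sigma_algebra.
Qed.

End history_spaces.

(** * Weak convergence and supports *)

Section weak_convergence.
Context (R : realType).

Lemma measurable_fun_continuousR (T : ptopologicalType) (f : T -> R) :
  continuous f -> measurable_fun setT (f : borel T -> R).
Proof.
move=> cf; apply: (measurability _ (RGenOpens.measurableE R)) => //.
move=> _ [_ [a [b ->] <-]]; rewrite setTI; apply: borel_open; apply: open_comp.
  by move=> y _; exact: cf.
exact: interval_open.
Qed.

Lemma weak_integral_continuous (T : ptopologicalType) (phi : bounded_continuous R T) :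
  continuous (fun mu : Mspace R T => (\int[mu]_x s2val phi x)%R).
Proof.
move=> mu V.
rewrite nbhsE => -[W [oW Wmu] WV].
have muF := (@cvg_sup _ _ (fun phi : bounded_continuous R T =>
    Topological.class (initial_topology
      (fun mu : Mspace R T => (\int[mu]_x s2val phi x)%R))) (nbhs mu) mu _).1
   (fun A => id) phi.
apply: muF; rewrite nbhsE.
exists ((fun mu : Mspace R T => (\int[mu]_x s2val phi x)%R) @^-1` W).
  by split => //; exists W.
by move=> nu; exact: WV.
Qed.

Lemma entourage_ball_rel (T : pmetricType R) (r : R) : 0 < r ->
  entourage [set xy : T * T | ball xy.1 r xy.2].
Proof. by move=> r0; rewrite -entourage_ballE; exists r. Qed.

(* [mu U] is the limit of the integrals of Urysohn functions converging to the
   indicator of [U], each of which is weakly continuous in [mu]. *)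
Lemma measurable_eval_open (T : pmetricType R) (U : set T) : open U ->
  measurable_fun setT (fun mu : borel (Mspace R T) => mu U).
Proof.
move=> oU; pose B n := [set x : T | ball x n.+1%:R^-1 `<=` U].
have sepB n : uniform_separator (~` U) (B n).
  apply: uniform_separatorW.
  exists [set xy : T * T | ball xy.1 n.+1%:R^-1 xy.2]; first exact: entourage_ball_rel.
  by apply/seteqP; split=> // -[x y] [[/= Ux Bx] xy]; apply/Ux/Bx/ball_sym.
pose phi n : T -> R := Urysohn (~` U) (B n).
have phi01 n x : 0 <= phi n x <= 1.
  have := @Urysohn_range T R (~` U) (B n) (phi n x); rewrite /= in_itv/=.
  by apply; exists x.
have phib n : exists M, forall x, `|phi n x| <= M.
  by exists 1 => x; have /andP[? ?] := phi01 n x; rewrite ger0_norm.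
pose bphi n : bounded_continuous R T :=
  exist2 _ _ (phi n) (@Urysohn_continuous T R (~` U) (B n)) (phib n).
have mphi n : measurable_fun setT (phi n : borel T -> R).
  by apply: measurable_fun_continuousR; exact: Urysohn_continuous.
have phiU x : phi n x @[n --> \oo] --> (\1_U x : R).
  rewrite indicE; case: (boolP (x \in U)); rewrite (inE, notin_setE) => Ux.
    apply: cvg_near_cst.
    have /nbhs_ballP[e /= e0 eU] := open_nbhs_nbhs (conj oU Ux).
    have [N] := ltr_add_invr e0; rewrite add0r => Ne.
    near=> n; apply: (Urysohn_sub1 (sepB n)); exists x => //.
    apply: subset_trans eU; apply: le_ball; apply: le_trans (ltW Ne).
    by rewrite lef_pV2 ?posrE// ler_nat ltnS; near: n; exists N.
  rewrite (_ : (fun n => phi n x) = cst 0); first exact: cvg_cst.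
  apply/funext => n; apply: (Urysohn_sub0 (sepB n)); by exists x.
have mU : measurable (U : set (borel T)) by exact: borel_open.
apply: (@emeasurable_fun_cvg _ _ _ _
  (fun n (mu : borel (Mspace R T)) => (\int[mu]_x phi n x)%R%:E)) => [n|mu _].
  apply/measurable_EFinP.
  exact: (@measurable_fun_continuousR (Mspace R T) _ (@weak_integral_continuous T (bphi n))).
have intphi n : (\int[mu]_x phi n x)%R%:E = (\int[mu]_x (phi n x)%:E)%E.
  rewrite /Rintegral fineK// ge0_fin_numE; last first.
    by apply: integral_ge0 => x _; rewrite lee_fin; have /andP[] := phi01 n x.
  apply: (@le_lt_trans _ _ (\int[mu]_x (1%:E))%E); last first.
    by rewrite integral_cst//= mul1e (probability_setT mu) ltry.
  apply: ge0_le_integral => //.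
  - by move=> x _; rewrite lee_fin; have /andP[] := phi01 n x.
  - exact/measurable_EFinP.
  - by move=> x _; rewrite lee_fin; have /andP[] := phi01 n x.
under eq_fun do rewrite intphi.
rewrite (_ : mu U = \int[mu]_x (\1_U x)%:E)%E; last by rewrite integral_indic ?setIT.
apply: (@dominated_cvg _ _ _ _ _ measurableT _ _ (cst 1%E)) => //.
- by move=> n; exact/measurable_EFinP.
- by move=> x _; apply: cvg_EFin => //; [exact: nearW|exact: phiU].
- exact: finite_measure_integrable_cst.
- by move=> n x _; have /andP[? ?] := phi01 n x; rewrite /= lee_fin ger0_norm.
Unshelve. all: by end_near. Qed.

(** It converts Borel measurability of a strategy for the weak topology into measurability of
    [f i t h B] in [h], that is, into a kernel. Open sets are stable under intersection, so the case
    of open sets extends by Dynkin induction. *)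
Lemma measurable_eval (T : pmetricType R) (B : set (borel T)) : measurable B ->
  measurable_fun setT (fun mu : borel (Mspace R T) => mu B).
Proof.
apply: (@dynkin_induction _ (borel T) (@open T) (fun B =>
  measurable_fun setT (fun mu : borel (Mspace R T) => mu B))) => //.
- exact: openI.
- exact: measurable_eval_open openT.
- exact: measurable_eval_open.
- move=> S mS mevS.
  rewrite [X in measurable_fun _ X](_ : _ =
    (fun mu : borel (Mspace R T) => 1 - mu S)%E); first exact: emeasurable_funB.
  by apply/funext => mu; exact: probability_setC.
- move=> F mF tF mevF.
  rewrite [X in measurable_fun _ X](_ : _ = (fun mu : borel (Mspace R T) =>
    \sum_(0 <= k <oo) mu (F k))%E); first exact: ge0_emeasurable_sum.
  by apply/funext => mu; rewrite measure_semi_bigcup//; exact: bigcup_measurable.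
Qed.

End weak_convergence.

Section support.
Context (R : realType) (T : ptopologicalType).
Implicit Types mu : Mspace R T.

Lemma closed_msupport mu : closed (msupport mu).
Proof. by apply: closed_bigI => C []. Qed.

(** The support is an intersection of possibly uncountably many closed sets of full measure. A
    countable base helps: the complement of the support is covered by the basic open sets of measure
    zero. *)
Lemma msupport_full mu : nat_based T -> mu (msupport mu) = 1%E.
Proof.
move=> [b [ob bb]].
have mS : measurable (msupport mu : set (borel T)).
  by apply: borel_closed; exact: closed_msupport.
suff : mu (~` msupport mu) = 0%E.
  move=> S0; have := probability_setC mu (measurableC mS).
  by rewrite setCK S0 sube0.
pose F n := if mu (b n) == 0%E then b n else set0.
have mF n : measurable (F n : set (borel T)).
  by rewrite /F; case: ifP => _; [exact: borel_open|exact: measurable0].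
have nF : mu (\bigcup_n F n) = 0%E.
  apply/negligibleP; first exact: bigcupT_measurable.
  apply: negligible_bigcup => n; apply/negligibleP => //.
  by rewrite /F; case: ifPn => [/eqP//|_]; rewrite measure0.
apply/eqP; rewrite eq_le measure_ge0 andbT -nF le_measure ?inE//.
- exact: measurableC.
- exact: bigcupT_measurable.
move=> x /existsNP[C /not_implyP[[cC C1] Cx]].
have [n bx bC] := bb x (~` C) (open_nbhs_nbhs (conj (closed_openC cC) Cx)).
exists n => //; rewrite /F ifT// eq_le measure_ge0 andbT.
apply: le_trans (_ : mu (~` C) <= _)%E.
  by rewrite le_measure ?inE//; [exact: borel_open|apply: borel_open; exact: closed_openC].
by rewrite probability_setC ?C1 ?subee//; exact: borel_closed.
Qed.

Lemma msupport_neq0 mu : nat_based T -> msupport mu !=set0.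
Proof.
move=> bT; apply/set0P/eqP => mu0.
by have := msupport_full mu bT; rewrite mu0 measure0 => /eqP; rewrite eq_sym onee_eq0.
Qed.

Lemma measure1_setI mu (A B : set (borel T)) : measurable A -> measurable B ->
  mu A = 1%E -> mu (A `&` B) = mu B.
Proof.
move=> mA mB A1; apply/eqP; rewrite eq_le; apply/andP; split.
  by rewrite le_measure ?inE//; exact: measurableI.
have A0 : mu (~` A) = 0%E by rewrite probability_setC// A1 subee.
have mCA : measurable (~` A `&` B) by apply: measurableI => //; exact: measurableC.
have BE : B = (A `&` B) `|` (~` A `&` B) by rewrite -setIUl setUv setTI.
have CA0 : mu (~` A `&` B) = 0%E.
  apply/eqP; rewrite eq_le measure_ge0 andbT -A0 le_measure ?inE//.
  exact: measurableC.
have dis : (A `&` B) `&` (~` A `&` B) = set0 by rewrite setIACA setICr set0I.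
have muB := measureU mu (measurableI _ _ mA mB) mCA dis.
move: muB; rewrite -BE => ->.
by rewrite [X in (_ + X <= _)%E](_ : _ = 0%E) ?adde0.
Qed.

(** This is how a singleton action set forces a player's move, whatever the profile: the support has
    measure 1, hence is not empty, hence is all of [[set a]]. *)
Lemma msupport_sub1 mu (a : T) : nat_based T -> msupport mu `<=` [set a] ->
  forall B : set (borel T), measurable B -> mu B = (\d_(a : borel T) B)%R.
Proof.
move=> bT mua B mB.
have [x mux] := msupport_neq0 mu bT.
have mue : msupport mu = [set a].
  by apply/seteqP; split => // y ->; rewrite -(mua _ mux).
have mS : measurable (msupport mu : set (borel T)).
  by apply: borel_closed; exact: closed_msupport.
have mu1 := msupport_full mu bT.
rewrite -(measure1_setI mS mB mu1) diracE; have [aB|aB] := boolP (a \in B).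
  rewrite inE in aB; rewrite (_ : _ `&` _ = msupport mu) ?mu1//.
  by rewrite mue; apply/setIidPl => y ->.
rewrite notin_setE in aB; rewrite mue (_ : _ `&` _ = set0) ?measure0//.
by apply/seteqP; split => // y [->].
Qed.

Lemma msupport_dirac (a : T) : hausdorff_space T ->
  msupport (mdirac R a) = [set a].
Proof.
move=> hT; have c1 : closed [set a].
  exact/accessible_closed_set1/hausdorff_accessible.
apply/seteqP; split.
  by move=> x; apply; split => //; rewrite /mdirac /= diracE mem_set.
move=> _ -> C [cC]; rewrite /mdirac /= diracE.
by case: (boolP (a \in C)); rewrite ?inE//= => _ /eqP; rewrite eq_sym onee_eq0.
Qed.

End support.

(** * Closedness of the sets of histories *)

Section closed_histories.
Context (R : realType) (n : nat) (G : game R n).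

(** The closed graph theorem for upper hemicontinuous correspondences with closed values, applied
    stage by stage. *)
Lemma closed_histories t : perfect_information_game G -> closed (histories G t).
Proof.
move=> hG; elim: t => [|t IH]; first exact: closedT.
rewrite -(setCK (histories G t.+1)) closedC openE => -[h [x s]] /= nh.
have [ht|ht] := pselect (histories G t h); last first.
  have hn : nbhs h (~` histories G t).
    exact: open_nbhs_nbhs (conj (closed_openC IH) ht).
  exists (~` histories G t, setT) => /=; first by split => //; exact: filterT.
  by move=> [h' z] [/= + _] => h'n [].
have /existsNP[i Ai] : ~ forall i, action G t i h (x i).
  by move=> Ax; apply: nh.
have cA : closed (action G t i h).
  by apply: compact_closed; [exact: metric_hausdorff|exact: action_compact].
(* Regularity separates the forbidden action [x i] from the closed action set: the complement of
   [closure C] is an open set containing the latter, to which upper hemicontinuity applies. *)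
have [C xC CA] := @uniform_regular (Xs G t i) (x i) (~` action G t i h)
  (open_nbhs_nbhs (conj (closed_openC cA) Ai)).
have cC : closed (closure C) by exact: closed_closure.
have /= := action_upper hG ht (closed_openC cC).
have AC : action G t i h `<=` ~` closure C by move=> y Ay Cy; exact: (CA y).
move=> /(_ AC) hC.
have xiC : nbhs (x, s) [set z : prod_topology (Xs G t) * Ss G t | C (z.1 i)].
  exists ([set y | C (y i)], setT) => /=; last by move=> [y s'] [].
  split; last exact: filterT.
  exact: (@proj_continuous _ (Xs G t) i x _ xC).
(* Hemicontinuity holds within [histories G t] only, hence the implication. *)
exists ([set y | histories G t y -> action G t i y `<=` ~` closure C],
  [set z : prod_topology (Xs G t) * Ss G t | C (z.1 i)]) => //=.
move=> [h' [x' s']] [/= h'C x'C] [/= h't h'A].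
exact: (h'C h't _ (h'A i)) (subset_closure x'C).
Qed.

End closed_histories.

(** * The Ionescu-Tulcea extension *)

Section prob_integral.
Context d1 d2 (S : measurableType d1) (T : measurableType d2) (R : realType).
Variable K : S -> probability T R.
Hypothesis mK : forall B, measurable B -> measurable_fun setT (fun s => K s B).

Let Kg (s : S) : giry T R := K s.

Let mKg : measurable_fun setT Kg.
Proof. by apply: measurable_giry_codensity. Qed.

Lemma measurable_kernel_integral (f : T -> \bar R) :
  measurable_fun setT f -> (forall x, 0 <= f x)%E ->
  measurable_fun setT (fun s => \int[K s]_x f x)%E.
Proof.
move=> mf f0.
exact: (measurableT_comp (measurable_giry_int mf f0) mKg).
Qed.

(** [nu] agrees with the Giry bind of [mu] and [K] on measurable sets, and integrals only depend on
    those values. *)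
Lemma integral_kernel_bind (mu : probability S R) (nu : probability T R)
    (f : T -> \bar R) :
  (forall B, measurable B -> nu B = \int[mu]_s K s B)%E ->
  measurable_fun setT f -> (forall x, 0 <= f x)%E ->
  (\int[nu]_x f x = \int[mu]_s \int[K s]_x f x)%E.
Proof.
move=> nuE mf f0.
rewrite -[RHS](giry_int_bind (mu : giry S R) mKg mf f0) /giry_int.
apply: eq_measure_integral => B mB _.
rewrite [LHS]nuE// /giry_bind /= /giry_join /=.
rewrite [RHS]giry_int_map//; exact: measurable_giry_ev.
Qed.

End prob_integral.

Lemma prob_eq_integral d (T : measurableType d) (R : realType)
    (mu nu : probability T R) (D : set T) (f : T -> \bar R) :
  (forall B, measurable B -> mu B = nu B) ->
  (\int[mu]_(x in D) f x = \int[nu]_(x in D) f x)%E.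
Proof. by move=> E; apply: eq_measure_integral => B mB _; exact: E. Qed.

Lemma finite_measure_unique d (T : measurableType d) (R : realType)
    (mu nu : {measure set T -> \bar R}) (G : set (set T)) :
  @measurable _ T = <<s G >> -> setI_closed G -> G setT ->
  (mu setT < +oo)%E ->
  (forall B, G B -> mu B = nu B) -> forall B, measurable B -> mu B = nu B.
Proof.
move=> mG GI GT fmu muG B mB.
apply: (@measure_unique _ _ _ G (fun=> setT)) => //.
by rewrite bigcup_const//; exists 0%N.
Qed.

Section cylinders.
Context (R : realType) (n : nat) (E : spaces R n).
Implicit Types (C D : set (Defs.path E)).

Definition level m C : Prop :=
  exists2 B : set (borel (hist E m)), measurable B & C = trunc m @^-1` B.

Lemma level_le m m' C : (m <= m')%N -> level m C -> level m' C.
Proof.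
elim: m' => [|m' IH]; first by rewrite leqn0 => /eqP->.
rewrite leq_eqVlt => /predU1P[->//|/IH{}IH /IH[B mB ->]].
exists [set hz | B hz.1] => //.
by have := borel_continuous (@hz1_continuous _ _ E m') measurableT mB; rewrite setTI.
Qed.

Lemma level_setU m C D : level m C -> level m D -> level m (C `|` D).
Proof.
move=> [A mA ->] [B mB ->]; exists (A `|` B) => //; exact: measurableU.
Qed.

Lemma level_setC m C : level m C -> level m (~` C).
Proof. by move=> [A mA ->]; exists (~` A) => //; exact: measurableC. Qed.

Lemma level_set0 m : level m set0.
Proof. by exists set0 => //; rewrite preimage_set0. Qed.

Lemma level_setT m : level m setT.
Proof. by exists setT. Qed.

Lemma level_trunc m C (z z' : Defs.path E) : level m C ->
  trunc m z = trunc m z' -> C z -> C z'.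
Proof. by move=> [B _ ->] /= ->. Qed.

Lemma level_measurable m C : level m C -> measurable (C : set (borel (Defs.path E))).
Proof.
move=> [B mB ->].
by have := borel_continuous (@trunc_continuous _ _ E m) measurableT mB; rewrite setTI.
Qed.

Lemma cylinderI : setI_closed (@cylinder R n E).
Proof.
move=> C D [k kC] [j jD].
have {}kC := level_le (leq_maxl k j) kC; have {}jD := level_le (leq_maxr k j) jD.
exists (maxn k j); have := level_setC (level_setU (level_setC kC) (level_setC jD)).
by rewrite setCU !setCK.
Qed.

(* A copy of [path] carrying the algebra of cylinders instead of the Borel sets. *)
Definition cylinder_path : Type := Defs.path E.

End cylinders.

Lemma cylinder_display : measure_display. Proof. by constructor. Qed.

Section cylinder_algebra.
Context (R : realType) (n : nat) (E : spaces R n).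

Let c0 : @cylinder R n E set0. Proof. by exists 0%N; exact: level_set0. Qed.

Let cU : setU_closed (@cylinder R n E).
Proof.
move=> C D [k kC] [j jD].
exists (maxn k j).
exact: level_setU (level_le (leq_maxl k j) kC) (level_le (leq_maxr k j) jD).
Qed.

Let cC : setC_closed (@cylinder R n E).
Proof. by move=> C [k kC]; exists k; exact: level_setC. Qed.

HB.instance Definition _ := Pointed.copy (cylinder_path E) (Defs.path E).
HB.instance Definition _ := isAlgebraOfSets.Build cylinder_display
  (cylinder_path E) c0 cU cC.

End cylinder_algebra.

Section ionescu_tulcea.
Context (R : realType) (n : nat) (E : spaces R n).
Hypothesis cX0 : compact [set: X0 E].
Variable K : forall t, hist E t -> Mspace R (hist E t.+1).
Hypothesis mK : forall t (B : set (borel (hist E t.+1))), measurable B ->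
  measurable_fun setT (fun h : borel (hist E t) => K h B).
Hypothesis K1 : forall t (h : hist E t) (A : set (borel (hist E t))),
  measurable A -> K h [set hz | A hz.1] = (\d_(h : borel (hist E t)) A)%R.

Implicit Types (C D : set (borel (Defs.path E))).
Local Open Scope ereal_scope.

(* The probability that the play from [h] ends up in [C] when it is frozen after
   [d] further stages; for a cylinder [C] it does not depend on a large [d]. *)
Fixpoint phi (d k : nat) C : borel (hist E k) -> \bar R :=
  if d is d'.+1 then fun h => \int[K h]_h' phi d' C (h' : borel (hist E k.+1))
  else fun h => (\1_C (ext h))%:E.

Lemma phi_ge0 d k C (h : borel (hist E k)) : 0 <= phi d C h.
Proof.
elim: d k h => [|d IH] k h; first by rewrite lee_fin.
by apply: integral_ge0 => h' _; exact: IH.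
Qed.

Lemma phi_measurable d k C : measurable C ->
  measurable_fun setT (@phi d k C).
Proof.
move=> mC; elim: d k => [|d IH] k.
  apply/measurable_EFinP.
  apply: (measurableT_comp (f := \1_C : borel (Defs.path E) -> R)).
    exact: measurable_indic.
  exact: (borel_continuous (@ext_continuous _ _ E k)).
apply: (@measurable_kernel_integral _ _ (borel (hist E k)) (borel (hist E k.+1)) R (@K k) _ (@phi d k.+1 C)) => //.
- exact: mK.
- by move=> x; exact: phi_ge0.
Qed.

Lemma ext_trunc_eq m k (h : hist E k.+1) : (m <= k)%N ->
  trunc m (ext h) = trunc m (ext h.1).
Proof.
move=> mk; apply: eq_trunc => j jm; rewrite /= dfwithout//.
by rewrite gtn_eqF// ltnS (leq_trans jm mk).
Qed.

Lemma indic_eq (T U : Type) (A : set T) (B : set U) (x : T) (y : U) : (A x <-> B y) ->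
  \1_A x = \1_B y :> R.
Proof.
move=> AB; rewrite !indicE; congr (nat_of_bool _)%:R.
by apply/idP/idP; rewrite !inE; case: AB.
Qed.

Lemma integral_K1 k (h : borel (hist E k)) (A : set (borel (hist E k))) :
  measurable A ->
  \int[K h]_(h' in setT) (\1_A (h' : borel (hist E k.+1)).1)%:E = (\1_A h)%:E.
Proof.
move=> mA.
rewrite (_ : (\1_A h)%:E = K h [set hz | A hz.1]); last by rewrite K1// diracE.
rewrite (eq_integral (fun h' : borel (hist E k.+1) =>
  (\1_[set hz : borel (hist E k.+1) | A hz.1] h')%:E)).
  rewrite integral_indic ?setIT//.
  by have := borel_continuous (@hz1_continuous _ _ E k) measurableT mA; rewrite setTI.
by move=> h' _; congr EFin; exact: indic_eq.
Qed.

(** A cylinder of level at most [k] is already decided at [h], and by [K1] the kernel never alters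
    the past. *)
Lemma phi_level d k m C (h : hist E k) : level m C -> (m <= k)%N ->
  phi d C h = (\1_C (ext h))%:E.
Proof.
move=> mC; elim: d k h => [//|d IH] k h mk /=.
have mA : measurable (ext (t:=k) @^-1` C : set (borel (hist E k))).
  have := borel_continuous (@ext_continuous _ _ E k) measurableT (level_measurable mC).
  by rewrite setTI.
rewrite -[RHS](integral_K1 h mA); apply: eq_integral => h' _.
rewrite IH; last exact: leqW.
congr EFin; apply: indic_eq.
by split; apply: level_trunc mC _; rewrite ext_trunc_eq.
Qed.

Lemma phi_stable d k m C (h : hist E k) : level m C -> (m <= k + d)%N ->
  phi d.+1 C h = phi d C h.
Proof.
move=> mC; elim: d k h => [|d IH] k h mk.
  by rewrite addn0 in mk; rewrite !(phi_level _ _ mC).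
by apply: eq_integral => h' _; apply: IH; rewrite addSnnS.
Qed.

Lemma phi_stable_le d d' k m C (h : hist E k) : level m C -> (m <= k + d)%N ->
  (d <= d')%N -> phi d' C h = phi d C h.
Proof.
move=> mC mk; elim: d' => [|d' IH]; first by rewrite leqn0 => /eqP->.
rewrite leq_eqVlt => /predU1P[->//|dd']; rewrite -IH// (phi_stable _ mC)//.
by rewrite (leq_trans mk)// leq_add2l.
Qed.

Lemma phi_additive d k C D (h : hist E k) : measurable C -> measurable D ->
  C `&` D = set0 -> phi d (C `|` D) h = phi d C h + phi d D h.
Proof.
move=> mC mD CD; elim: d k h => [|d IH] k h.
  exact: (measureU (\d_(ext h : borel (Defs.path E)))%R mC mD CD).
transitivity (\int[K h]_h' (phi d C (h' : borel (hist E k.+1)) + phi d D h')).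
  by apply: eq_integral => h' _; exact: IH.
apply: ge0_integralD => //.
- by move=> x _; exact: phi_ge0.
- exact: (@phi_measurable d k.+1 C mC).
- by move=> x _; exact: phi_ge0.
- exact: (@phi_measurable d k.+1 D mD).
Qed.

Definition cyl_level C : nat := xget 0%N [set m | level m C].

Lemma cyl_levelP C : @cylinder R n E C -> level (cyl_level C) C.
Proof. by move=> [m mC]; apply: (@xgetPex _ 0%N [set m | level m C]); exists m. Qed.

(** A depth of [cyl_level C] is enough from every stage [k], since [k + cyl_level C] is at least the
    level; by [phi_stable_le] the arbitrary choice of the level does not matter. *)
Definition content k (h : borel (hist E k)) (C : set (cylinder_path E)) : \bar R :=
  phi (cyl_level C) C h.

Lemma contentE d k m C (h : hist E k) : level m C -> (m <= k + d)%N ->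
  content h C = phi d C h.
Proof.
move=> mC mk; have lC := cyl_levelP (ex_intro _ m mC).
rewrite /content -(phi_stable_le _ mC mk (leq_maxr (cyl_level C) d)).
by rewrite -(phi_stable_le _ lC (leq_addl _ _) (leq_maxl _ d)).
Qed.

Lemma content_level k m C (h : hist E k) : level m C -> (m <= k)%N ->
  content h C = (\1_C (ext h))%:E.
Proof. by move=> mC mk; rewrite (@contentE 0 _ m) ?addn0. Qed.

Lemma content_ge0 k (h : hist E k) C : 0 <= content h C.
Proof. exact: phi_ge0. Qed.

Lemma content_measurable k C : measurable C ->
  measurable_fun setT (fun h : borel (hist E k) => content h C).
Proof. by move=> mC; exact: phi_measurable. Qed.

Lemma content_step k C (h : hist E k) : @cylinder R n E C ->
  content h C = \int[K h]_h' content (h' : borel (hist E k.+1)) C.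
Proof.
move=> cC; have lC := cyl_levelP cC.
by rewrite (@contentE (cyl_level C).+1 _ (cyl_level C))// -addSnnS leq_addl.
Qed.

Lemma cylinder_measurable C : @cylinder R n E C -> measurable C.
Proof. by move=> [m mC]; exact: level_measurable mC. Qed.

(* If the cover fails at [h], it fails at some successor of [h]; iterating, it
   fails along a whole path [z], although [z] lies in some member of the cover. *)
Lemma content_cover_step C (F : nat -> set (cylinder_path E)) k (h : hist E k) :
  @cylinder R n E C -> (forall i, @cylinder R n E (F i)) ->
  \sum_(i <oo) content h (F i) < content h C ->
  exists h' : hist E k.+1, h'.1 = h /\
    \sum_(i <oo) content h' (F i) < content h' C.
Proof.
move=> cC cF; apply: contraPP => /forallNP nex; apply/negP; rewrite -leNgt.
rewrite content_step//.
under eq_eseriesr do rewrite content_step//.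
rewrite -integral_nneseries//; last 2 first.
- by move=> i; apply: content_measurable; exact: cylinder_measurable.
- by move=> i h' _; exact: content_ge0.
have mD : measurable ([set hz | hz.1 = h] : set (borel (hist E k.+1))).
  have := borel_continuous (@hz1_continuous _ _ E k) measurableT
    (borel_closed (@closed_hist1 _ _ E k h)).
  by rewrite setTI.
apply: ae_ge0_le_integral => //.
- by move=> h' _; exact: content_ge0.
- by apply: content_measurable; exact: cylinder_measurable.
- by move=> h' _; apply: nneseries_ge0 => i _ _; exact: content_ge0.
- apply: ge0_emeasurable_sum => [*|i _]; first exact: content_ge0.
  by apply: content_measurable; exact: cylinder_measurable.
(* The absence of a bad successor says something about the extensions of [h] only. By [K1] these
   have full measure, so an almost everywhere comparison is enough. *)
exists (~` [set hz : borel (hist E k.+1) | hz.1 = h]); split.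
- exact: measurableC.
- rewrite [LHS]probability_setC// (_ : K h _ = 1) ?subee//.
  by rewrite (K1 h (borel_closed (@closed_hist1 _ _ E k h))) diracE mem_set.
- move=> h' /= + h'h; apply => _.
  by rewrite leNgt; apply/negP => lt; apply: (nex h').
Qed.

Section content_cover.
Variables (t : nat) (h0 : hist E t) (C : set (cylinder_path E)).
Variable F : nat -> set (cylinder_path E).
Hypotheses (cC : @cylinder R n E C) (cF : forall i, @cylinder R n E (F i)).
Hypothesis CF : C `<=` \bigcup_i F i.

Let bad k (h : hist E k) := \sum_(i <oo) content h (F i) < content h C.

Let next k (h : hist E k) : hist E k.+1 :=
  xget point [set h' : hist E k.+1 | h'.1 = h /\ bad h'].

Let nextP k (h : hist E k) : bad h -> (next h).1 = h /\ bad (next h).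
Proof.
move=> bh; apply: (@xgetPex _ point [set h' : hist E k.+1 | h'.1 = h /\ bad h']).
exact: content_cover_step.
Qed.

(** With [j + t] rather than [t + j], the stage [j.+1 + t] reduces to [(j + t).+1], the one reached
    by [next]. *)
Let hseq : forall j, hist E (j + t) :=
  fix hseq j := if j is j'.+1 then next (hseq j') else h0.

Lemma content_subadditive : content h0 C <= \sum_(i <oo) content h0 (F i).
Proof.
rewrite leNgt; apply/negP => bad0.
have badj j : bad (hseq j).
  by elim: j => [//|j /nextP[]].
pose a j := ext (hseq j).
have aS j i : (i <= j + t)%N -> a j.+1 i = a j i.
  move=> ij; rewrite /a /= dfwithout ?(gtn_eqF _)//.
  by rewrite (nextP (badj j)).1.
have aE j j' i : (i <= j + t)%N -> (j <= j')%N -> a j' i = a j i.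
  move=> ij; elim: j' => [|j' IH]; first by rewrite leqn0 => /eqP->.
  rewrite leq_eqVlt => /predU1P[->//|jj']; rewrite aS ?IH//.
  by rewrite (leq_trans ij)// leq_add2r.
(* Diagonal choice: coordinate [i] no longer changes along [a] from index [i] on, as
   [i <= i + t]. *)
pose z : Defs.path E := fun i => a i i.
have zE j : trunc (j + t) z = trunc (j + t) (ext (hseq j)).
  apply: eq_trunc => i ij; rewrite /z.
  have [le|/ltnW le] := leqP i j; first by rewrite -/(a j) (aE i j) ?leq_addr.
  by rewrite (aE j i).
have zC D j m : level m D -> (m <= j)%N -> content (hseq j) D = (\1_D z)%:E.
  move=> mD mj; have mjt : (m <= j + t)%N by rewrite (leq_trans mj)// leq_addr.
  rewrite (content_level _ mD)//; congr EFin; apply: indic_eq.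
  by split; apply: (level_trunc (level_le mjt mD)); rewrite zE.
have F0 j : 0 <= \sum_(i <oo) content (hseq j) (F i).
  by apply: nneseries_ge0 => i _ _; exact: content_ge0.
have [m mC] := cC.
have Cz : C z.
  have := le_lt_trans (F0 m) (badj m); rewrite (zC _ _ _ mC)// indicE.
  by case: (boolP (z \in C)); rewrite ?inE// ltxx.
have [i _ Fiz] := CF Cz.
have [m' mF] := cF i.
(* At this stage both [C] and [F i] are decided and contain [z], so both have content 1: the cover
   cannot fail here. *)
have := badj (maxn m m'); apply/negP; rewrite -leNgt.
rewrite (zC _ _ _ mC) ?leq_maxl//.
apply: (@le_trans _ _ (content (hseq (maxn m m')) (F i))).
  by rewrite (zC _ _ _ mF) ?leq_maxr// lee_fin !indicE !mem_set.
rewrite (@nneseriesD1 _ _ i xpredT)//; last by move=> j _; exact: content_ge0.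
by rewrite leeDl//; apply: nneseries_ge0 => j _ _; exact: content_ge0.
Qed.

End content_cover.

Section extension.
Variables (t : nat) (h : hist E t).

Let mu : set (cylinder_path E) -> \bar R := content h.

Let mu_ge0 C : 0 <= mu C. Proof. exact: content_ge0. Qed.

Let mu0 : mu set0 = 0.
Proof.
by rewrite /mu (@contentE 0 _ 0 _ _ (level_set0 E 0))// /= indic0.
Qed.

Let mu_semi_additive : measure_function.semi_additive mu.
Proof.
apply/(additive2P mu0) => C D [m mC] [k kD] CD.
have {}mC := level_le (leq_maxl m k) mC; have {}kD := level_le (leq_maxr m k) kD.
rewrite /mu (@contentE (maxn m k) _ _ _ _ (level_setU mC kD)) ?leq_addl//.
rewrite (@contentE (maxn m k) _ _ _ _ mC) ?leq_addl//.
rewrite (@contentE (maxn m k) _ _ _ _ kD) ?leq_addl//.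
by apply: phi_additive => //; [exact: level_measurable mC|exact: level_measurable kD].
Qed.

HB.instance Definition _ := isContent.Build _ _ _ mu mu_ge0 mu_semi_additive.

Let mu_subadditive : measurable_subset_sigma_subadditive mu.
Proof. by move=> C F cF cC CF; exact: content_subadditive. Qed.

HB.instance Definition _ :=
  Content_SigmaSubAdditive_isMeasure.Build _ _ _ mu mu_subadditive.

Let ext_mu := measure_extension mu.

Let ext_muE C : @cylinder R n E C -> ext_mu C = content h C.
Proof. by move=> cC; exact: measurable_mu_extE. Qed.

(** The extended measure lives on the sigma-algebra generated by cylinders. The identity is
    measurable from it to the Borel sets by [borel_cylinder], so pushing forward gives a Borel
    law. *)
Let idm (z : g_sigma_algebraType (@measurable _ (cylinder_path E))) :
  borel (Defs.path E) := z.

Let midm : measurable_fun setT idm.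
Proof. by move=> _ B mB; rewrite setTI; move: mB; rewrite borel_cylinder. Qed.

Let law : set (borel (Defs.path E)) -> \bar R := pushforward ext_mu idm.

Let law0 : law set0 = 0. Proof. exact: measure0. Qed.

Let law_ge0 A : 0 <= law A. Proof. exact: measure_ge0. Qed.

Let law_sigma_additive : semi_sigma_additive law.
Proof.
by move=> F mF tF mUF; exact: measure_semi_sigma_additive.
Qed.

HB.instance Definition _ := isMeasure.Build _ _ _ law
  law0 law_ge0 law_sigma_additive.

Let law1 : law setT = 1.
Proof.
rewrite /law /pushforward preimage_setT ext_muE; last by exists 0%N; exact: level_setT.
by rewrite (@contentE 0 _ 0 _ _ (level_setT E 0))// /= indicT.
Qed.

HB.instance Definition _ := Measure_isProbability.Build _ _ _ law law1.

Lemma ionescu_tulcea_exists : exists tau : Mspace R (Defs.path E),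
  forall C, @cylinder R n E C -> tau C = content h C.
Proof. by exists law => C cC; rewrite -ext_muE. Qed.

End extension.

Definition play_law t (h : hist E t) : Mspace R (Defs.path E) :=
  projT1 (cid (ionescu_tulcea_exists h)).

Lemma play_lawE t (h : hist E t) C : @cylinder R n E C ->
  play_law h C = content h C.
Proof. by move: C; exact: projT2 (cid (ionescu_tulcea_exists h)). Qed.

Lemma measurable_play_law t C : measurable C ->
  measurable_fun setT (fun h : borel (hist E t) => play_law h C).
Proof.
rewrite borel_cylinder//.
apply: (@dynkin_induction _ (borel (Defs.path E)) (@cylinder R n E) (fun C =>
  measurable_fun setT (fun h : borel (hist E t) => play_law h C))) => //.
- exact: borel_cylinder.
- exact: cylinderI.
- rewrite (_ : (fun _ => _) = cst 1); first exact: measurable_cst.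
  by apply/funext => h; exact: probability_setT.
- move=> D cD; rewrite (_ : (fun _ => _) = (fun h : borel (hist E t) => content h D)).
    by apply: content_measurable; exact: cylinder_measurable.
  by apply/funext => h; exact: play_lawE.
- move=> S mS mevS.
  rewrite (_ : (fun _ => _) = (fun h : borel (hist E t) => 1 - play_law h S)).
    exact: emeasurable_funB.
  by apply/funext => h; exact: probability_setC.
- move=> F mF tF mevF.
  rewrite [X in measurable_fun _ X](_ : _ = (fun h : borel (hist E t) =>
    \sum_(0 <= k <oo) play_law h (F k))); first exact: ge0_emeasurable_sum.
  by apply/funext => h; rewrite measure_semi_bigcup//; exact: bigcup_measurable.
Qed.

Lemma play_law_trunc t (h : hist E t) (A : set (borel (hist E t))) : measurable A ->
  play_law h (trunc t @^-1` A) = (\d_(h : borel (hist E t)) A)%R.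
Proof.
move=> mA; have lA : level t (trunc t @^-1` A) by exists A.
rewrite play_lawE; last by exists t.
rewrite (content_level _ lA)//; congr EFin; apply: indic_eq.
by rewrite /preimage/= trunc_ext.
Qed.

(** Both sides are measures in [C] that agree on cylinders, by [content_step]; the right side is the
    Giry bind [nu] of the first move and the law of the continuation. *)
Lemma play_law_step t (h : hist E t) C : measurable C ->
  play_law h C = \int[K h]_h' play_law (h' : borel (hist E t.+1)) C.
Proof.
have mKg : measurable_fun setT
    (fun h : borel (hist E t.+1) => play_law h : giry (borel (Defs.path E)) R).
  by apply: measurable_giry_codensity => // B mB; exact: measurable_play_law.
pose nu := giry_bind (K h : giry (borel (hist E t.+1)) R) mKg.
have nuE B : measurable B ->
    nu B = \int[K h]_h' play_law (h' : borel (hist E t.+1)) B.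
  move=> mB; rewrite /nu /giry_bind /= /giry_join /=.
  by rewrite [LHS]giry_int_map//; exact: measurable_giry_ev.
move=> mC; rewrite -nuE//.
apply: (@finite_measure_unique _ _ _ (play_law h) nu (@cylinder R n E)) => //.
- exact: borel_cylinder.
- exact: cylinderI.
- by exists 0%N; exact: level_setT.
- exact: (le_lt_trans (probability_le1 (play_law h) measurableT) (ltry 1%R)).
move=> D cD; apply: etrans (esym (nuE _ (cylinder_measurable cD))).
apply: etrans (play_lawE h cD) _; rewrite content_step//.
by apply: eq_integral => h' _; rewrite play_lawE.
Qed.

Lemma integral_play_law t (h : hist E t) (f : borel (Defs.path E) -> \bar R) :
  measurable_fun setT f -> (forall z, 0 <= f z) ->
  \int[play_law h]_z f z =
  \int[K h]_h' \int[play_law (h' : borel (hist E t.+1))]_z f z.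
Proof.
move=> mf f0.
apply: (@integral_kernel_bind _ _ (borel (hist E t.+1)) (borel (Defs.path E))) => //.
- by move=> B mB; exact: measurable_play_law.
- by move=> B mB; exact: play_law_step.
Qed.

(** Induction on [k - t]. When [t = k], the truncation at [k] is almost surely [h]; otherwise
    [play_law_step] moves the starting point one stage forward on both sides. *)
Lemma play_law_markov t k (h : hist E t) (B : set (borel (hist E k.+1))) :
  measurable B -> (t <= k)%N ->
  play_law h (trunc k.+1 @^-1` B) =
  \int[play_law h]_z K (trunc k z) B.
Proof.
move=> mB; have mKB := mK mB.
have mtr j : measurable_fun setT
    (trunc j : borel (Defs.path E) -> borel (hist E j)).
  exact: (borel_continuous (@trunc_continuous _ _ E j)).
have mKt : measurable_fun setT (fun z : borel (Defs.path E) => K (trunc k z) B).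
  exact: (measurableT_comp mKB (mtr k)).
have cB : level k.+1 (trunc k.+1 @^-1` B) by exists B.
move: {2}(k - t)%N (erefl (k - t)%N) => d; elim: d t h => [|d IH] t h kt tk.
  have {}tk : t = k by apply/eqP; rewrite eqn_leq tk/= -subn_eq0 kt.
  subst t.
  have KB0 (h' : borel (hist E k)) : 0 <= K h' B by exact: measure_ge0.
  apply: etrans _ (giry_int_map (mtr k) (play_law h : giry _ R) mKB KB0).
  rewrite /giry_int (@eq_measure_integral _ _ _ _ (\d_(h : borel (hist E k)))%R); last first.
    by move=> A mA _; exact: play_law_trunc.
  rewrite integral_dirac// diracT mul1e.
  rewrite play_lawE; last by exists k.+1.
  rewrite (@contentE 1 _ _ _ _ cB) ?addn1//=.
  transitivity (\int[K h]_h' (\1_B (h' : borel (hist E k.+1)))%:E); last first.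
    by rewrite integral_indic ?setIT.
  apply: eq_integral => h' _; congr EFin; apply: indic_eq.
  by rewrite /preimage/= -/(ext (h' : hist E k.+1)) -/(trunc k.+1 _) trunc_ext.
rewrite play_law_step; last exact: level_measurable cB.
rewrite integral_play_law//; apply: eq_integral => h' _.
apply: IH; first by rewrite subnS kt.
by rewrite -subn_gt0 kt.
Qed.

End ionescu_tulcea.

(** * The law of play *)

Lemma ord2P (i : 'I_2) : i = ord0 \/ i = ord_max.
Proof. by case: i => [[|[|//]]] ilt; [left|right]; exact/val_inj. Qed.

Lemma ord2_all (P : 'I_2 -> Prop) : P ord0 -> P ord_max -> forall i, P i.
Proof. by move=> P0 P1 i; have [->|->] := ord2P i. Qed.

Section product_law.
Context (R : realType) (E : spaces R 2).
Hypothesis cX0 : compact [set: X0 E].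
Variables (t : nat) (h : hist E t) (mu : forall i, Mspace R (Xs E t i)).
Variable nu : Mspace R (Ss E t).
Local Open Scope ereal_scope.

Let P2 := giry_prod (mu ord0 : giry _ R, mu ord_max : giry _ R).
Let P3 := giry_prod (P2, nu : giry (borel (Ss E t)) R).

(** A dependent family over ['I_2] rebuilt from a pair, since the product measures are binary; the
    base [point] is overwritten at both indices. *)
Let moves (a : Xs E t ord0) (b : Xs E t ord_max) : prod_topology (Xs E t) :=
  dfwith (dfwith (point : prod_topology (Xs E t)) ord0 a) ord_max b.

Let moves0 a b : moves a b ord0 = a.
Proof. by rewrite /moves dfwithout// dfwithin. Qed.

Let moves1 a b : moves a b ord_max = b.
Proof. by rewrite /moves dfwithin. Qed.

Let F (abs : borel (Xs E t ord0) * borel (Xs E t ord_max) * borel (Ss E t)) :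
  borel (hist E t.+1) := (h, (moves abs.1.1 abs.1.2, abs.2)).

Let F_rectangle (A : set (borel (hist E t))) (B : forall i, set (borel (Xs E t i)))
    (C : set (borel (Ss E t))) :
  F @^-1` [set hz | [/\ A hz.1, forall i, B i (hz.2.1 i) & C hz.2.2]] =
  if h \in A then B ord0 `*` B ord_max `*` C else set0.
Proof.
case: ifPn; rewrite (inE, notin_setE) => Ah; apply/seteqP; split=> //.
- move=> [[a b] s] [/= _ Bab Cs]; split=> //; split.
    by have := Bab ord0; rewrite moves0.
  by have := Bab ord_max; rewrite moves1.
- by move=> [[a b] s] [/= [? ?] ?]; split=> //=; apply: ord2_all; rewrite ?moves0 ?moves1.
- by move=> abs [].
Qed.

(** By [borel_rectangle] only preimages of rectangles need checking, and these are products of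
    measurable sets or empty. *)
Let mF : measurable_fun setT F.
Proof.
apply: (measurability _ (borel_rectangle cX0 t)) => // _ [_ [A [B [C [mA mB mC ->]]]] <-].
rewrite setTI F_rectangle; case: ifP => // _.
by do 2! apply: measurableX => //.
Qed.

Let law : set (borel (hist E t.+1)) -> \bar R := pushforward P3 F.

Let law0 : law set0 = 0. Proof. exact: measure0. Qed.

Let law_ge0 A : 0 <= law A. Proof. exact: measure_ge0. Qed.

Let law_sigma_additive : semi_sigma_additive law.
Proof.
move=> D mD tD mUD; rewrite /law /pushforward preimage_bigcup.
apply: (@measure_semi_sigma_additive _ _ _ P3 (fun n => F @^-1` D n)).
- by move=> n; have := mF measurableT (mD n); rewrite setTI.
- apply/trivIsetP => /= i j _ _ ij; rewrite -preimage_setI.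
  by move/trivIsetP : tD => /(_ _ _ _ _ ij) ->//; rewrite preimage_set0.
- by rewrite -preimage_bigcup; have := mF measurableT mUD; rewrite setTI.
Qed.

HB.instance Definition _ := isMeasure.Build _ _ _ law
  law0 law_ge0 law_sigma_additive.

Let law_rectangle (A : set (borel (hist E t))) (B : forall i, set (borel (Xs E t i)))
    (C : set (borel (Ss E t))) :
  measurable A -> (forall i, measurable (B i)) -> measurable C ->
  law [set hz | [/\ A hz.1, forall i, B i (hz.2.1 i) & C hz.2.2]] =
  (\d_(h : borel (hist E t)) A)%R *
    ((\big[*%E/1%E]_(i < 2) mu i (B i)) * nu C).
Proof.
move=> mA mB mC; rewrite /law /pushforward F_rectangle diracE.
case: (boolP (h \in A)) => Ah; last by rewrite measure0 mul0e.
rewrite mul1e big_ord_recl big_ord_recl big_ord0 mule1.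
rewrite (_ : lift ord0 ord0 = ord_max); last exact/val_inj.
rewrite /P3 /giry_prod /=.
apply: etrans (product_measure1E _ _ (measurableX (mB ord0) (mB ord_max)) mC) _.
by congr (_ * _); exact: product_measure1E.
Qed.

Let law1 : law setT = 1.
Proof.
rewrite (_ : setT = [set hz : borel (hist E t.+1) |
  [/\ setT hz.1, forall i, setT (hz.2.1 i) & setT hz.2.2]]); last first.
  by apply/seteqP; split.
rewrite (@law_rectangle setT (fun=> setT))// diracT mul1e.
rewrite big1 ?mul1e; first exact: probability_setT.
by move=> i _; exact: probability_setT.
Qed.

HB.instance Definition _ := Measure_isProbability.Build _ _ _ law law1.

Lemma product_law_exists : exists P : Mspace R (hist E t.+1),
  forall (A : set (borel (hist E t))) (B : forall i, set (borel (Xs E t i)))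
    (C : set (borel (Ss E t))),
  measurable A -> (forall i, measurable (B i)) -> measurable C ->
  P [set hz | [/\ A hz.1, forall i, B i (hz.2.1 i) & C hz.2.2]] =
  (\d_(h : borel (hist E t)) A)%R *
    ((\big[*%E/1%E]_(i < 2) mu i (B i)) * nu C).
Proof. by exists law; exact: law_rectangle. Qed.

End product_law.

Lemma within_continuous_borel (T U : ptopologicalType) (D : set T) (f : T -> U) :
  measurable (D : set (borel T)) -> {within D, continuous f} ->
  measurable_fun (D : set (borel T)) (f : borel T -> borel U).
Proof.
move=> mD cf; apply: (@measurability _ _ (borel T) (borel U) D f (@open U)) => //.
move=> _ [W oW <-].
have oS : open (f @^-1` W : set (subspace D)) by move/continuousP: cf; exact.
have [V oV VW] := (open_subspaceP D _).1 oS.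
rewrite setIC -VW; apply: measurableI => //; exact: borel_open.
Qed.

(** * The one-stage transition kernel of a profile *)

Section step_kernel.
Context (R : realType) (G : game R 2).
Hypothesis hG : perfect_information_game G.
Variable f : profile G.
Arguments f : clear implicits.
Hypothesis hf : is_profile f.
Local Open Scope ereal_scope.

Let cX0 : compact [set: X0 G] := compact_X0 hG.

Lemma measurable_histories t : measurable (histories G t : set (borel (hist G t))).
Proof. by apply: borel_closed; exact: closed_histories. Qed.

Lemma is_profile_measurable i t (B : set (borel (Xs G t i))) : measurable B ->
  measurable_fun (histories G t : set (borel (hist G t))) (fun h => f i t h B).
Proof.
move=> mB; have [mfi _] := hf i t.
exact: (measurable_comp measurableT (@subsetT _ _) (measurable_eval mB) mfi).
Qed.

Lemma nature_measurable t (B : set (borel (Ss G t))) : measurable B ->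
  measurable_fun (histories G t : set (borel (hist G t))) (fun h => nature G t h B).
Proof.
move=> mB; have mn := within_continuous_borel (@measurable_histories t)
  (@nature_continuous _ _ _ hG t).
exact: (measurable_comp measurableT (@subsetT _ _) (measurable_eval mB) mn).
Qed.

Lemma profile_action1 i t h : histories G t h ->
  f i t h (action G t i h) = 1.
Proof.
move=> ht; have [_ /(_ h ht) sA] := hf i t.
have cA : closed (action G t i h).
  by apply: compact_closed; [exact: metric_hausdorff|exact: action_compact].
have mA := borel_closed cA.
have mS := borel_closed (@closed_msupport _ _ (f i t h)).
apply/eqP; rewrite eq_le probability_le1//=.
rewrite -(msupport_full (f i t h) (separable_nat_based _)).
by rewrite le_measure ?inE.
Qed.

(* The junk value outside [histories] makes [step] a kernel on the whole space. *)
Definition step t (h : hist G t) : Mspace R (hist G t.+1) :=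
  projT1 (cid (product_law_exists cX0 h
    (fun i => if `[< histories G t h >] then f i t h else mdirac R point)
    (if `[< histories G t h >] then nature G t h else mdirac R point))).

Lemma stepE t (h : hist G t) (A : set (borel (hist G t)))
    (B : forall i, set (borel (Xs G t i))) (C : set (borel (Ss G t))) :
  measurable A -> (forall i, measurable (B i)) -> measurable C ->
  step h [set hz | [/\ A hz.1, forall i, B i (hz.2.1 i) & C hz.2.2]] =
  (\d_(h : borel (hist G t)) A)%R *
    ((\big[*%E/1%E]_(i < 2)
       (if `[< histories G t h >] then f i t h else mdirac R point) (B i)) *
     (if `[< histories G t h >] then nature G t h else mdirac R point) C).
Proof. by rewrite /step; case: cid => P /=; exact. Qed.

Lemma stepT t (h : hist G t) (A : set (borel (hist G t)))
    (B : forall i, set (borel (Xs G t i))) (C : set (borel (Ss G t))) :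
  histories G t h ->
  measurable A -> (forall i, measurable (B i)) -> measurable C ->
  step h [set hz | [/\ A hz.1, forall i, B i (hz.2.1 i) & C hz.2.2]] =
  (\d_(h : borel (hist G t)) A)%R *
    ((\big[*%E/1%E]_(i < 2) f i t h (B i)) * nature G t h C).
Proof. by move=> ht mA mB mC; rewrite stepE// asboolT. Qed.

Lemma measurable_step t (D : set (borel (hist G t.+1))) : measurable D ->
  measurable_fun setT (fun h : borel (hist G t) => step h D).
Proof.
rewrite borel_rectangle//.
apply: (@dynkin_induction _ (borel (hist G t.+1)) (@rectangle R 2 G t) (fun D =>
  measurable_fun setT (fun h : borel (hist G t) => step h D))) => //.
- exact: borel_rectangle.
- exact: rectangleI.
- rewrite (_ : (fun _ => _) = cst 1); first exact: measurable_cst.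
  by apply/funext => h; exact: probability_setT.
- move=> _ [A [B [C [mA mB mC ->]]]].
  rewrite -(setUv (histories G t : set (borel (hist G t)))).
  have mH := @measurable_histories t.
  apply/measurable_funU => //; first exact: measurableC.
  have mdA H : measurable_fun H (fun h : borel (hist G t) =>
      (\d_(h : borel (hist G t)) A)%R : \bar R).
    by apply: measurable_funTS; exact: measurable_fun_dirac.
  split.
    apply: (eq_measurable_fun (fun h : borel (hist G t) =>
      (\d_(h : borel (hist G t)) A)%R *
        ((f ord0 t h (B ord0) * f ord_max t h (B ord_max)) * nature G t h C))).
      move=> h; rewrite inE => ht; rewrite stepT//.
      rewrite big_ord_recl big_ord_recl big_ord0 mule1.
      by rewrite (_ : lift ord0 ord0 = ord_max)//; exact/val_inj.
    apply: emeasurable_funM => //; apply: emeasurable_funM; last exact: nature_measurable.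
    by apply: emeasurable_funM; exact: is_profile_measurable.
  apply: (eq_measurable_fun (fun h : borel (hist G t) =>
      (\d_(h : borel (hist G t)) A)%R *
        ((\big[*%E/1%E]_(i < 2) mdirac R (point : Xs G t i) (B i)) *
         mdirac R (point : Ss G t) C))).
    by move=> h; rewrite inE => ht; rewrite stepE// asboolF.
  by apply: emeasurable_funM => //; exact: measurable_cst.
- move=> S mS mevS.
  rewrite (_ : (fun _ => _) = (fun h : borel (hist G t) => 1 - step h S)).
    exact: emeasurable_funB.
  by apply/funext => h; exact: probability_setC.
- move=> F mF tF mevF.
  rewrite [X in measurable_fun _ X](_ : _ = (fun h : borel (hist G t) =>
    \sum_(0 <= k <oo) step h (F k))); first exact: ge0_emeasurable_sum.
  by apply/funext => h; rewrite measure_semi_bigcup//; exact: bigcup_measurable.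
Qed.

Lemma step_fst t (h : hist G t) (A : set (borel (hist G t))) : measurable A ->
  step h [set hz | A hz.1] = (\d_(h : borel (hist G t)) A)%R.
Proof.
move=> mA.
rewrite (_ : [set hz | A hz.1] = [set hz : borel (hist G t.+1) |
  [/\ A hz.1, forall i, setT (hz.2.1 i) & setT hz.2.2]]); last first.
  by apply/seteqP; split => [x Ax|x []].
rewrite (@stepE _ _ A (fun=> setT) setT)// big1; last first.
  by move=> i _; exact: probability_setT.
by rewrite mul1e probability_setT mule1.
Qed.

(** [C] is a set of full measure for Nature's move: [setT] in general, or the single point [s] where
    Nature plays a Dirac measure at [s]. *)
Definition successors t (h : hist G t) (C : set (borel (Ss G t))) :
    set (borel (hist G t.+1)) :=
  [set hz | [/\ hz.1 = h, forall i, action G t i h (hz.2.1 i) & C hz.2.2]].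

Lemma measurable_action t i (h : hist G t) : histories G t h ->
  measurable (action G t i h : set (borel (Xs G t i))).
Proof.
move=> ht; apply: borel_closed; apply: compact_closed; first exact: metric_hausdorff.
exact: action_compact.
Qed.

Lemma measurable_successors t (h : hist G t) C : histories G t h ->
  measurable C -> measurable (successors h C).
Proof.
move=> ht mC; apply: measurable_rectangle.
exists [set h], (fun i => action G t i h), C; split=> //.
- exact: borel_closed (@closed_hist1 _ _ G t h).
- by move=> i; exact: measurable_action.
Qed.

Lemma step_successors t (h : hist G t) C : histories G t h ->
  measurable C -> nature G t h C = 1 -> step h (successors h C) = 1.
Proof.
move=> ht mC C1.
rewrite (@stepT t h [set h] (fun i => action G t i h) C)//; last 2 first.
- exact: borel_closed (@closed_hist1 _ _ G t h).
- by move=> i; exact: measurable_action.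
rewrite diracE mem_set// mul1e big1 ?mul1e// => i _.
exact: profile_action1.
Qed.

Definition law t (h : hist G t) : Mspace R (Defs.path G) :=
  play_law cX0 measurable_step step_fst h.

End step_kernel.

Section probability_facts.
Context d (T : measurableType d) (R : realType) (mu : probability T R).
Local Open Scope ereal_scope.

Lemma prob_integral_restrict (A : set T) (f : T -> \bar R) : measurable A ->
  mu A = 1 -> measurable_fun setT f -> (forall x, 0 <= f x) ->
  \int[mu]_x f x = \int[mu]_(x in A) f x.
Proof.
move=> mA A1 mf f0.
have CA0 : mu (~` A) = 0 by rewrite probability_setC// A1 subee.
rewrite (ge0_negligible_integral (measurableC mA) measurableT mf _ CA0)//.
by rewrite setTD setCK.
Qed.

Lemma prob1_subset (A B : set T) : measurable A -> measurable B -> A `<=` B ->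
  mu A = 1 -> mu B = 1.
Proof.
move=> mA mB AB A1; apply/eqP; rewrite eq_le probability_le1//= -A1.
by rewrite le_measure ?inE.
Qed.

Lemma prob1_bigcap (A : nat -> set T) : (forall k, measurable (A k)) ->
  (forall k, mu (A k) = 1) -> mu (\bigcap_k A k) = 1.
Proof.
move=> mA A1.
have mC : measurable (\bigcup_k ~` A k).
  by apply: bigcupT_measurable => k; exact: measurableC.
have C0 : mu (\bigcup_k ~` A k) = 0.
  apply/negligibleP => //; apply: negligible_bigcup => k.
  apply/negligibleP; first exact: measurableC.
  by apply: etrans (probability_setC mu (mA k)) _; rewrite A1 subee.
rewrite (_ : \bigcap_k A k = ~` \bigcup_k ~` A k).
  by rewrite probability_setC// C0 sube0.
by rewrite setC_bigcup; apply: eq_bigcapr => k _; rewrite setCK.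
Qed.

(** Some value of [f] reaches its mean [c]. Otherwise [c - f] would be positive on [A] with integral
    zero, hence zero almost everywhere on a set of measure 1. *)
Lemma prob_integral_ge (A : set T) (f : T -> R) (c : R) : measurable A ->
  mu A = 1 -> measurable_fun A f -> (forall x, A x -> (0 <= f x)%R) ->
  \int[mu]_(x in A) (f x)%:E = c%:E -> exists2 x, A x & (c <= f x)%R.
Proof.
move=> mA A1 mf f0 fc; apply: contrapT => /forall2NP nf.
have fltc x : A x -> (f x < c)%R.
  by move=> Ax; rewrite ltNge; apply/negP; have [|] := nf x.
have if_ : mu.-integrable A (EFin \o f).
  apply/integrableP; split; first exact/measurable_EFinP.
  rewrite (eq_integral (fun x => (f x)%:E)) ?fc ?ltry// => x.
  by rewrite inE => Ax /=; rewrite ger0_norm// f0.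
have ic : mu.-integrable A (EFin \o cst c) by exact: finite_measure_integrable_cst.
have g0 : \int[mu]_(x in A) `|(c - f x)%:E| = 0.
  rewrite (eq_integral (fun x => (cst c x)%:E - (f x)%:E)); last first.
    move=> x; rewrite inE => Ax /=; rewrite ger0_norm// subr_ge0 ltW//.
    exact: fltc.
  rewrite integralB_EFin// fc (_ : \int[mu]_(x in A) (cst c x)%:E = c%:E) ?subee//.
  by rewrite [LHS](integral_cst mu mA c%:E) -[RHS]mule1 -A1.
have mg : measurable_fun A (fun x => (c - f x)%:E).
  by apply/measurable_EFinP; apply: measurable_funB => //; exact: measurable_cst.
have [N [mN N0 AN]] := (ae_eq_integral_abs mu mA mg).1 g0.
have : mu A <= mu N.
  rewrite le_measure ?inE// => x Ax; apply: AN => /= /(_ Ax) [] /eqP.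
  by rewrite subr_eq0 => /eqP cf; have := fltc x Ax; rewrite cf ltxx.
by rewrite A1 N0 lee_fin ler10.
Qed.

End probability_facts.

Lemma pushforward_prob d1 d2 (S : measurableType d1) (T : measurableType d2)
    (R : realType) (mu : probability S R) (f : S -> T) : measurable_fun setT f ->
  exists nu : probability T R, forall B, measurable B -> nu B = mu (f @^-1` B).
Proof.
move=> mf; pose X : {mfun S >-> T} := HB.pack f (isMeasurableFun.Build _ _ _ _ f mf).
by exists (distribution mu X).
Qed.

Lemma histories_le (R : realType) (n : nat) (G : game R n) (z : Defs.path G) k k' :
  (k <= k')%N -> histories G k' (trunc k' z) -> histories G k (trunc k z).
Proof.
elim: k' => [|k' IH]; first by rewrite leqn0 => /eqP->.
by rewrite leq_eqVlt => /predU1P[->//|/IH{}IH] /= [/IH].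
Qed.

(** * Existence and uniqueness of the law of play *)

Section outcome.
Context (R : realType) (G : game R 2).
Hypothesis hG : perfect_information_game G.
Variable f : profile G.
Arguments f : clear implicits.
Hypothesis hf : is_profile f.
Local Open Scope ereal_scope.

Local Notation law := (law hG hf).
Local Notation step := (step hG f).

Lemma measurable_trunc t : measurable_fun setT
  (trunc t : borel (Defs.path G) -> borel (hist G t)).
Proof. exact: (borel_continuous (@trunc_continuous _ _ G t)). Qed.

Lemma measurable_trunc_pre t (B : set (borel (hist G t))) : measurable B ->
  measurable (trunc t @^-1` B : set (borel (Defs.path G))).
Proof. by move=> mB; have := @measurable_trunc t measurableT _ mB; rewrite setTI. Qed.

(** A later truncation in [histories] controls the earlier ones, so a law starting at stage [t] is
    only examined from [t] on. *)
Lemma plays_bigcap t : plays G =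
  \bigcap_j ((trunc (j + t) : Defs.path G -> _) @^-1` histories G (j + t)).
Proof.
apply/seteqP; split=> [z pz j _|z pz k]; first exact: pz.
by apply: (@histories_le _ _ _ _ k (k + t)); [exact: leq_addr|exact: pz].
Qed.

Lemma measurable_plays : measurable (plays G : set (borel (Defs.path G))).
Proof.
rewrite (plays_bigcap 0); apply: bigcapT_measurable => j.
by apply: measurable_trunc_pre; exact: measurable_histories.
Qed.

Lemma step_histories1 t (h : hist G t) : histories G t h ->
  step h (histories G t.+1) = 1.
Proof.
move=> ht; have nT := probability_setT (nature G t h).
apply: prob1_subset (step_successors hG hf ht measurableT nT).
- exact: measurable_successors.
- exact: measurable_histories.
- by move=> [h' z] [/= -> ].
Qed.

Lemma law_trunc t (h : hist G t) (A : set (borel (hist G t))) : measurable A ->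
  law h (trunc t @^-1` A) = (\d_(h : borel (hist G t)) A)%R.
Proof. exact: play_law_trunc. Qed.

Lemma law_markov t k (h : hist G t) (B : set (borel (hist G k.+1))) :
  measurable B -> (t <= k)%N ->
  law h (trunc k.+1 @^-1` B) = \int[law h]_z step (trunc k z) B.
Proof. exact: play_law_markov. Qed.

Lemma law_histories t k (h : hist G t) : histories G t h ->
  law h (trunc (k + t) @^-1` histories G (k + t)) = 1.
Proof.
move=> ht; elim: k => [|k IH].
  by rewrite law_trunc ?diracE ?mem_set//; exact: measurable_histories.
have mH j := @measurable_trunc_pre j _ (@measurable_histories _ _ hG j).
rewrite law_markov ?leq_addl//; last exact: measurable_histories.
have mstep : measurable_fun setT (fun z : borel (Defs.path G) =>
    step (trunc (k + t) z) (histories G (k + t).+1)).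
  apply: (measurableT_comp (measurable_step hG hf _) (@measurable_trunc (k + t))).
  exact: measurable_histories.
rewrite (prob_integral_restrict (mH _) IH mstep)//.
rewrite (eq_integral (cst 1)) ?integral_cst ?mul1e//.
by move=> z; rewrite inE => zH; exact: step_histories1.
Qed.

Lemma law_plays t (h : hist G t) : histories G t h -> law h (plays G) = 1.
Proof.
move=> ht; rewrite (plays_bigcap t); apply: prob1_bigcap => j.
  by apply: measurable_trunc_pre; exact: measurable_histories.
exact: law_histories.
Qed.

Lemma law_is_outcome t (h : hist G t) : histories G t h -> is_outcome f h (law h).
Proof.
move=> ht; split; first exact: law_plays.
pose tau_ k := projT1 (cid (pushforward_prob (law h) (@measurable_trunc k))).
have tauE k (B : set (borel (hist G k))) : measurable B ->
    tau_ k B = law h (trunc k @^-1` B).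
  by move: B; exact: projT2 (cid (pushforward_prob (law h) (@measurable_trunc k))).
exists tau_; split=> [B mB|k tk A B C mA AH mB mC|k tk B mB].
- by rewrite tauE// law_trunc.
- have mrect : measurable ([set hz | [/\ A hz.1, forall i, B i (hz.2.1 i) & C hz.2.2]]
      : set (borel (hist G k.+1))).
    by apply: measurable_rectangle; exists A, B, C.
  rewrite tauE// law_markov//.
  have ms := measurable_step hG hf mrect.
  have ms0 (h' : borel (hist G k)) : 0 <= step h'
      [set hz | [/\ A hz.1, forall i, B i (hz.2.1 i) & C hz.2.2]].
    exact: measure_ge0.
  apply: etrans (esym (giry_int_map (@measurable_trunc k) (law h : giry _ R) ms ms0)) _.
  rewrite /giry_int (@eq_measure_integral _ _ _ _ (tau_ k)); last first.
    by move=> D mD _; exact: esym (tauE _ _ mD).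
  rewrite [RHS]integral_mkcond; apply: eq_integral => h' _.
  rewrite patchE; case: ifPn; rewrite (inE, notin_setE) => Ah'.
    by rewrite stepT ?diracE ?mem_set ?mul1e//; exact: AH.
  by rewrite stepE// diracE memNset// mul0e.
- exact: esym (tauE _ _ _).
Qed.

(** [is_diamond] only constrains rectangles whose base lies in [histories]. Taking the base to be
    [histories] itself shows that [mu] is concentrated above it, so any base may be intersected with
    [histories]. *)
Lemma diamond_rectangle t (lam : Mspace R (hist G t)) (mu : Mspace R (hist G t.+1))
    (A : set (borel (hist G t))) (B : forall i, set (borel (Xs G t i)))
    (C : set (borel (Ss G t))) :
  is_diamond f lam mu -> lam (histories G t) = 1 ->
  measurable A -> (forall i, measurable (B i)) -> measurable C ->
  mu [set hz | [/\ A hz.1, forall i, B i (hz.2.1 i) & C hz.2.2]] =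
  \int[lam]_(h in A `&` histories G t)
    ((\big[*%E/1%E]_(i < 2) f i t h (B i)) * nature G t h C).
Proof.
move=> dm lam1 mA mB mC.
have mH := @measurable_histories _ _ hG t.
have mrect (D : set (borel (hist G t))) : measurable D ->
    measurable ([set hz | [/\ D hz.1, forall i, B i (hz.2.1 i) & C hz.2.2]]
      : set (borel (hist G t.+1))).
  by move=> mD; apply: measurable_rectangle; exists D, B, C.
have mH1 : measurable ([set hz | histories G t hz.1] : set (borel (hist G t.+1))).
  by have := borel_continuous (@hz1_continuous _ _ G t) measurableT mH; rewrite setTI.
have muH : mu [set hz | histories G t hz.1] = 1.
  rewrite (_ : [set hz | _] = [set hz : borel (hist G t.+1) | [/\ histories G t hz.1,
    forall i, setT (hz.2.1 i) & setT hz.2.2]]); last first.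
    by apply/seteqP; split => [x Hx|x []].
  rewrite (dm (histories G t) (fun=> setT) setT)// (eq_integral (cst 1)).
    by rewrite integral_cst// mul1e.
  move=> h _; rewrite big1 ?mul1e; first exact: probability_setT.
  by move=> i _; exact: probability_setT.
rewrite -(dm (A `&` histories G t) B C)//; last exact: measurableI.
rewrite -(measure1_setI mH1 (mrect A mA) muH); congr (mu _).
by apply/seteqP; split => [x [/= ? []]|x [/= [? ?]]].
Qed.

(** The marginals agree by induction on the stage, starting from the Dirac measure at stage [t],
    because rectangles determine each of them; cylinders then determine the law on paths. *)
Lemma outcome_unique t (h : hist G t) (tau tau' : Mspace R (Defs.path G)) :
  histories G t h -> is_outcome f h tau -> is_outcome f h tau' ->
  forall B : set (borel (Defs.path G)), measurable B -> tau B = tau' B.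
Proof.
move=> ht [tau1 [tau_ [tau_t dtau tauE]]] [tau'1 [tau'_ [tau'_t dtau' tau'E]]].
have mH k := @measurable_histories _ _ hG k.
have H1 (sig : Mspace R (Defs.path G)) k : sig (plays G) = 1 ->
    sig (trunc k @^-1` histories G k) = 1.
  move=> s1; apply: prob1_subset s1; first exact: measurable_plays.
    exact: measurable_trunc_pre.
  by move=> z; exact.
have tauk k : (t <= k)%N -> tau_ k (histories G k) = 1.
  by move=> tk; rewrite -tauE// H1.
have tau'k k : (t <= k)%N -> tau'_ k (histories G k) = 1.
  by move=> tk; rewrite -tau'E// H1.
have E k : (t <= k)%N -> forall B : set (borel (hist G k)), measurable B ->
    tau_ k B = tau'_ k B.
  elim: k => [|k IH].
    by rewrite leqn0 => /eqP t0; subst t => B mB; rewrite tau_t// tau'_t.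
  rewrite leq_eqVlt => /predU1P[tk|tk].
    by subst t => B mB; rewrite tau_t// tau'_t.
  have {}IH := IH tk.
  apply: (finite_measure_unique (borel_rectangle (compact_X0 hG) k)).
  - exact: rectangleI.
  - by exists setT, (fun=> setT), setT; split => //; apply/seteqP; split.
  - exact: (le_lt_trans (probability_le1 (tau_ k.+1) measurableT) (ltry 1%R)).
  move=> _ [A [B [C [mA mB mC ->]]]].
  apply: etrans (diamond_rectangle (dtau _ tk) (tauk _ tk) mA mB mC) _.
  apply: etrans _ (esym (diamond_rectangle (dtau' _ tk) (tau'k _ tk) mA mB mC)).
  by apply: eq_measure_integral => D mD _; exact: IH.
apply: (finite_measure_unique (borel_cylinder (compact_X0 hG))).
- exact: cylinderI.
- by exists 0%N; exact: level_setT.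
- exact: (le_lt_trans (probability_le1 tau measurableT) (ltry 1%R)).
move=> C [m mC].
have [B mB ->] := level_le (leq_maxr t m) mC.
have tm := leq_maxl t m.
apply: etrans (tauE _ tm _ mB) _; apply: etrans _ (esym (tau'E _ tm _ mB)).
exact: E.
Qed.

(** Whatever law [get] selects, uniqueness identifies it with the constructed one on Borel sets. *)
Lemma outcome_law t (h : hist G t) : histories G t h ->
  forall B : set (borel (Defs.path G)), measurable B -> outcome f h B = law h B.
Proof.
move=> ht; apply: outcome_unique (law_is_outcome ht) => //.
exact: (@getPex _ (is_outcome f h) (ex_intro _ _ (law_is_outcome ht))).
Qed.

End outcome.

(** * Payoffs as integrals over successors *)

(** Changes both sides of an inequality along given equations, without a search for a pattern in the
    goal. *)
Lemma le_eq2 d (T : porderType d) (a b c e : T) :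
  a = c -> b = e -> (c <= e)%O -> (a <= b)%O.
Proof. by move=> -> ->. Qed.

Lemma le_EFin_integral d (T : measurableType d) (R : realType)
    (mu : probability T R) (A : set T) (f g : T -> R) : measurable A ->
  measurable_fun A f -> measurable_fun A g -> (forall x, A x -> 0 <= f x) ->
  (forall x, A x -> f x <= g x) ->
  (\int[mu]_(x in A) (f x)%:E <= \int[mu]_(x in A) (g x)%:E)%E.
Proof.
move=> mA mf mg f0 fg; apply: ge0_le_integral => //; try exact/measurable_EFinP.
Qed.

Lemma prob_integral_cst d (T : measurableType d) (R : realType)
    (mu : probability T R) (A : set T) (c : R) : measurable A -> mu A = 1%E ->
  (\int[mu]_(x in A) c%:E = c%:E)%E.
Proof.
move=> mA A1; have := integral_cst mu mA c%:E.
by rewrite (_ : (_ * _)%E = c%:E)// -[RHS]mule1 -A1.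
Qed.

Section utility.
Context (R : realType) (G : game R 2).
Hypothesis hG : perfect_information_game G.

Lemma measurable_utility i :
  measurable_fun (plays G : set (borel (Defs.path G))) (utility G i).
Proof.
have mu := within_continuous_borel (measurable_plays hG) (@utility_continuous _ _ _ hG i).
have mid : measurable_fun setT (id : borel R -> R).
  by apply: measurable_fun_continuousR => x; exact: cvg_id.
exact: (measurable_comp measurableT (@subsetT _ _) mid mu).
Qed.

Lemma utility_bound : exists2 M : R, 0 <= M &
  forall i z, plays G z -> `|utility G i z| <= M.
Proof.
have [M HM] := utility_bounded hG.
by exists `|M| => // i z pz; rewrite (le_trans (HM i z pz))// ler_norm.
Qed.

Lemma integrable_utility i (mu : Mspace R (Defs.path G)) :
  mu.-integrable (plays G : set (borel (Defs.path G))) (EFin \o utility G i).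
Proof.
have [M M0 uM] := utility_bound.
apply: measurable_bounded_integrable.
- exact: measurable_plays.
- exact: (le_lt_trans (probability_le1 mu (measurable_plays hG)) (ltry 1%R)).
- exact: measurable_utility.
- exists M; split; rewrite ?num_real// => x Mx y py.
  exact: le_trans (uM i y py) (ltW Mx).
Qed.

Variable f : profile G.
Arguments f : clear implicits.
Hypothesis hf : is_profile f.

Lemma payoff_law i t (h : hist G t) : histories G t h ->
  payoff i f h = \int[law hG hf h]_(z in plays G) utility G i z.
Proof.
move=> ht; rewrite /payoff /Rintegral; congr fine.
by apply: prob_eq_integral => B mB; exact: outcome_law.
Qed.

Lemma payoff_sum c t (h : hist G t) : histories G t h ->
  (forall z, plays G z -> utility G ord0 z + utility G ord_max z = c) ->
  payoff ord0 f h + payoff ord_max f h = c.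
Proof.
move=> ht uc; rewrite !payoff_law//.
have mP := measurable_plays hG.
rewrite -RintegralD//; try exact: integrable_utility.
rewrite (@eq_Rintegral _ _ _ _ _ (cst c)); last first.
  by move=> z; rewrite inE => /uc.
rewrite Rintegral_cst// (_ : fine _ = 1) ?mulr1//.
exact: (congr1 fine (law_plays hG hf ht)).
Qed.

(* Shifting by a bound of the utility makes it nonnegative, so that the integral
   can be iterated in [\bar R] without integrability conditions. *)
Definition shifted_utility i (M : R) : borel (Defs.path G) -> \bar R :=
  (fun z => (utility G i z + M)%:E) \_ (plays G).

Lemma shifted_utility_ge0 i M z :
  (forall z, plays G z -> `|utility G i z| <= M) ->
  (0 <= shifted_utility i M z)%E.
Proof.
move=> uM; rewrite /shifted_utility patchE; case: ifPn => //; rewrite inE => pz.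
by rewrite lee_fin -lerBlDr sub0r; have := uM z pz; rewrite ler_norml => /andP[].
Qed.

Lemma measurable_shifted_utility i M : measurable_fun setT (shifted_utility i M).
Proof.
have mf : measurable_fun (plays G : set (borel (Defs.path G)))
    (fun z : borel (Defs.path G) => (utility G i z + M)%:E).
  apply/measurable_EFinP.
  by apply: measurable_funD; [exact: measurable_utility|exact: measurable_cst].
exact: (measurable_restrictT _ (measurable_plays hG)).1 mf.
Qed.

Lemma payoff_shifted i M t (h : hist G t) : histories G t h ->
  (payoff i f h + M)%:E = (\int[law hG hf h]_z shifted_utility i M z)%E.
Proof.
move=> ht; have mP := measurable_plays hG.
have iu := integrable_utility i (law hG hf h).
have lt1 : (law hG hf h (plays G) < +oo)%E by rewrite law_plays// ltry.
rewrite -integral_mkcond /=.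
under [RHS]eq_integral do rewrite EFinD.
rewrite integralD_EFin//; last exact: finite_measure_integrable_cst.
have cM : (\int[law hG hf h]_(x in plays G) M%:E = M%:E)%E.
  by apply: prob_integral_cst => //; exact: law_plays.
rewrite [X in (_ + X)%E]cM EFinD.
by rewrite payoff_law// /Rintegral fineK//; exact: integrable_fin_num.
Qed.

Lemma successors_histories t (h : hist G t) C h' : histories G t h ->
  successors h C h' -> histories G t.+1 h'.
Proof. by case: h' => h' z ht [/= -> ]. Qed.

(** [play_law_step] integrated, then restricted to the successors of [h], which have probability 1.
    All three facts are stated on successors because [payoff] is only meaningful on histories. *)
Lemma payoff_step i M t (h : hist G t) C : histories G t h ->
  measurable C -> nature G t h C = 1%E ->
  (forall z, plays G z -> `|utility G i z| <= M) ->
  [/\ measurable_fun (successors h C) (fun h' => payoff i f h' + M),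
      forall h', successors h C h' -> 0 <= payoff i f h' + M &
      (payoff i f h + M)%:E =
      (\int[step hG f h]_(h' in successors h C) (payoff i f h' + M)%:E)%E].
Proof.
move=> ht mC C1 uM; have w0 z := shifted_utility_ge0 z uM.
have mw := measurable_shifted_utility i M.
have mV : measurable_fun setT (fun h' : borel (hist G t.+1) =>
    \int[law hG hf h']_z shifted_utility i M z)%E.
  apply: (@measurable_kernel_integral _ _ (borel (hist G t.+1)) (borel (Defs.path G))
    R (fun h' => law hG hf h')) => // B mB.
  exact: measurable_play_law.
have VE h' : successors h C h' -> (payoff i f h' + M)%:E =
    (\int[law hG hf h']_z shifted_utility i M z)%E.
  by move=> /(successors_histories ht) h't; exact: payoff_shifted.
have V0 (h' : borel (hist G t.+1)) :
    (0 <= \int[law hG hf h']_z shifted_utility i M z)%E by exact: integral_ge0.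
split.
- apply/measurable_EFinP.
  apply: (eq_measurable_fun (fun h' : borel (hist G t.+1) =>
    \int[law hG hf h']_z shifted_utility i M z)%E).
    by move=> h'; rewrite inE => h's; rewrite /= VE.
  exact: measurable_funTS.
- by move=> h' h's; rewrite -lee_fin VE.
rewrite payoff_shifted// [LHS]integral_play_law//.
have S1 := step_successors hG hf ht mC C1.
apply: etrans (prob_integral_restrict (measurable_successors hG ht mC) S1 mV V0) _.
by apply: eq_integral => h'; rewrite inE => h's; rewrite VE.
Qed.

(** Serves in place of a maximum over successors: an average is at most one of the values
    averaged. *)
Lemma payoff_le_successor i t (h : hist G t) C : histories G t h ->
  measurable C -> nature G t h C = 1%E ->
  exists2 h', successors h C h' & payoff i f h <= payoff i f h'.
Proof.
move=> ht mC C1; have [M M0 uM] := utility_bound.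
have [mV V0 Veq] := payoff_step ht mC C1 (uM i).
have [h' h's le] := prob_integral_ge (measurable_successors hG ht mC)
  (step_successors hG hf ht mC C1) mV V0 (esym Veq).
by exists h' => //; rewrite -(lerD2r M).
Qed.

Lemma payoff_deterministic i t (h : hist G t) (x : forall j, Xs G t j) (s : Ss G t) :
  histories G t h -> (forall j, action G t j h (x j)) ->
  (forall j (B : set (borel (Xs G t j))), measurable B ->
     f j t h B = (\d_(x j : borel (Xs G t j)) B)%R) ->
  is_dirac_at (nature G t h) s ->
  payoff i f h = payoff i f ((h, (x, s)) : hist G t.+1).
Proof.
move=> ht xA fx ns; have [M M0 uM] := utility_bound.
have nT := probability_setT (nature G t h).
have [mV V0 Veq] := payoff_step ht measurableT nT (uM i).
pose h' : hist G t.+1 := (h, (x, s)).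
have h's : successors h setT h' by split.
(* The kernel is determined on rectangles, where Dirac moves leave only the masses 0 and 1. *)
have stepd (D : set (borel (hist G t.+1))) : measurable D ->
    step hG f h D = (\d_(h' : borel (hist G t.+1)) D)%R.
  move: D; apply: (finite_measure_unique (borel_rectangle (compact_X0 hG) t)).
  - exact: rectangleI.
  - by exists setT, (fun=> setT), setT; split => //; apply/seteqP; split.
  - exact: (le_lt_trans (probability_le1 (step hG f h) measurableT) (ltry 1%R)).
  move=> _ [A [B [C [mA mB mC ->]]]].
  apply: etrans (stepT hG f ht mA mB mC) _.
  rewrite ns// (eq_bigr (fun j => (\d_(x j : borel (Xs G t j)) (B j))%R)); last first.
    by move=> j _; exact: fx.
  transitivity ((h' \in [set hz : borel (hist G t.+1) |
    [/\ A hz.1, forall j, B j (hz.2.1 j) & C hz.2.2]])%:R%:E : \bar R); last by [].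
  rewrite !diracE.
  have [hA|hA] := boolP (h \in A); last first.
    rewrite mul0e memNset// => -[/= ? _ _]; move/negP: hA; apply; exact: mem_set.
  have [sC|sC] := boolP (s \in C); last first.
    rewrite mule0 mule0 memNset// => -[/= _ _ ?]; move/negP: sC; apply; exact: mem_set.
  rewrite mul1e mule1.
  have [xB|/existsNP[j xB]] := pselect (forall j, B j (x j)).
    rewrite big1 ?mem_set//; last by move=> j _; rewrite diracE mem_set.
    by split=> //=; apply/set_mem.
  rewrite (bigD1 j)//= diracE memNset// mul0e memNset//.
  by move=> [/= _ /(_ j)].
have int : (payoff i f h + M)%:E = (payoff i f h' + M)%:E.
  apply: etrans Veq _.
  apply: etrans (@eq_measure_integral _ _ _ _ (\d_(h' : borel (hist G t.+1)))%R _ _ _) _.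
    by move=> D mD _; exact: stepd.
  rewrite integral_dirac; last 2 first.
  - exact: measurable_successors.
  - exact/measurable_EFinP.
  by rewrite diracE mem_set// mul1e.
exact: addIr (EFin_inj int).
Qed.

End utility.

(** * Comparing the payoffs of two profiles *)

Section comparison.
Context (R : realType) (G : game R 2).
Hypothesis hG : perfect_information_game G.

(** Agreement is on Borel sets only: this is all that a common singleton action set yields. *)
Definition same_moves (p q : profile G) t (h : hist G t) : Prop :=
  forall i (B : set (borel (Xs G t i))), measurable B -> p i t h B = q i t h B.

Lemma step_same_moves (p q : profile G) t (h : hist G t) : histories G t h ->
  same_moves p q h -> forall D : set (borel (hist G t.+1)), measurable D ->
  step hG p h D = step hG q h D.
Proof.
move=> ht pq; apply: (finite_measure_unique (borel_rectangle (compact_X0 hG) t)).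
- exact: rectangleI.
- by exists setT, (fun=> setT), setT; split => //; apply/seteqP; split.
- exact: (le_lt_trans (probability_le1 (step hG p h) measurableT) (ltry 1%R)).
move=> _ [A [B [C [mA mB mC ->]]]].
apply: etrans (stepT hG p ht mA mB mC) _.
apply: etrans _ (esym (stepT hG q ht mA mB mC)).
by congr (_ * (_ * _))%E; apply: eq_bigr => i _; exact: pq.
Qed.

(** With a common transition kernel at [h], the one-stage formula is monotone in the continuation
    payoffs. *)
Lemma payoff_le_same_moves (p q : profile G) i t (h : hist G t) :
  is_profile p -> is_profile q -> histories G t h -> same_moves p q h ->
  (forall h', successors h setT h' -> payoff i p h' <= payoff i q h') ->
  payoff i p h <= payoff i q h.
Proof.
move=> hp hq ht pq le; have [M M0 uM] := utility_bound hG.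
have nT := probability_setT (nature G t h).
have [mp p0 pE] := payoff_step hG hp ht measurableT nT (uM i).
have [mq q0 qE] := payoff_step hG hq ht measurableT nT (uM i).
rewrite -(lerD2r M) -lee_fin; apply: (le_eq2 pE qE).
apply: le_eq2 (prob_eq_integral _ _ (step_same_moves ht pq)) erefl _.
have H := @le_EFin_integral _ _ _ (step hG q h) _ _ _ (measurable_successors hG ht measurableT) mp mq p0.
apply: H => h' h's.
by rewrite lerD2r; exact: le.
Qed.

(** Payoffs at stage [t] ignore earlier moves: the two profiles have the same outcomes as sets of
    laws, so [get] returns the same law. *)
Lemma payoff_same_moves (p q : profile G) i t (h : hist G t) : histories G t h ->
  (forall k (h' : hist G k), (t <= k)%N -> histories G k h' -> same_moves p q h') ->
  payoff i p h = payoff i q h.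
Proof.
move=> ht pq; rewrite /payoff /outcome.
suff -> : is_outcome p h = is_outcome q h by [].
have sub (p' q' : profile G) :
    (forall k (h' : hist G k), (t <= k)%N -> histories G k h' -> same_moves p' q' h') ->
    forall tau, is_outcome p' h tau -> is_outcome q' h tau.
  move=> pq' tau [tau1 [tau_ [tau_t dtau tauE]]]; split=> //; exists tau_; split=> //.
  move=> k tk A B C mA AH mB mC; rewrite dtau//.
  apply: eq_integral => h'; rewrite inE => Ah'.
  congr (_ * _)%E; apply: eq_bigr => j _; apply: pq' => //; exact: AH.
apply/seteqP; split; apply: sub => // k h' tk h't j B mB.
by rewrite (pq k h' tk h't).
Qed.

Lemma payoff_same_moves_step (p q : profile G) i t (h : hist G t) :
  is_profile p -> is_profile q -> histories G t h -> same_moves p q h ->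
  (forall h', successors h setT h' -> payoff i p h' = payoff i q h') ->
  payoff i p h = payoff i q h.
Proof.
move=> hp hq ht pq E; apply/le_anti/andP; split.
  apply: (payoff_le_same_moves hp hq ht pq) => h' h's.
  exact: le_eq2 (E _ h's) erefl (lexx _).
apply: (payoff_le_same_moves hq hp ht) => [j B mB|h' h's]; first exact: esym (pq j B mB).
exact: le_eq2 (esym (E _ h's)) erefl (lexx _).
Qed.

End comparison.

(** * Equilibria and realizations *)

(* Conversion would otherwise unfold payoffs down to the measures. *)
#[local] Opaque payoff.

Definition other (i : 'I_2) : 'I_2 := if i == ord0 then ord_max else ord0.

Lemma other_neq i : other i != i.
Proof. by move: i; apply: ord2_all. Qed.

Lemma neq_other i j : j != i -> j = other i.
Proof. by have [->|->] := ord2P i; have [->|->] := ord2P j. Qed.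

Section strategies.
Context (R : realType) (G : game R 2).
Hypothesis hG : perfect_information_game G.

Definition is_stage_strategy i t (m : hist G t -> Mspace R (Xs G t i)) : Prop :=
  measurable_fun (histories G t : set (borel (hist G t)))
    (m : borel (hist G t) -> borel (Mspace R (Xs G t i))) /\
  forall h, histories G t h -> msupport (m h) `<=` action G t i h.

Lemma is_strategy_dfwith i (u : strategy G i) t (m : hist G t -> Mspace R (Xs G t i)) :
  is_strategy u -> is_stage_strategy m ->
  is_strategy (dfwith u t m : strategy G i).
Proof.
move=> su sm k.
suff : is_stage_strategy (dfwith u t m k) by [].
by case: (dfwithP u m k) => [|j _]; [exact: sm|exact: su].
Qed.

Lemma is_profile_dfwith (p : profile G) i (u : strategy G i) :
  is_profile p -> is_strategy u -> is_profile (dfwith p i u).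
Proof. by move=> hp hu j; case: (dfwithP p u j) => [|k _]; [exact: hu|exact: hp]. Qed.

Lemma is_profile_stage (p q : profile G) t : is_profile p -> is_profile q ->
  is_profile (fun i => dfwith (p i) t (@q i t) : strategy G i).
Proof. by move=> hp hq i; apply: is_strategy_dfwith => //; exact: hq. Qed.

(** Changing a strategy at one history keeps it measurable because [[set h]] is closed, hence
    Borel. *)
Lemma is_strategy_play_at (u : profile G) i t (h : hist G t) (a : Xs G t i) :
  is_profile u -> action G t i h a ->
  is_strategy (dfwith (u i) t
    (fun h' => if h' == h then mdirac R a else @u i t h') : strategy G i).
Proof.
move=> hu Aa; apply: is_strategy_dfwith; first exact: hu.
have [mu su] := hu i t.
have mh : measurable ([set h] : set (borel (hist G t))).
  exact: borel_closed (@closed_hist1 _ _ G t h).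
have mH := @measurable_histories _ _ hG t.
split; last first.
  move=> h' h't; case: eqP => [->|_]; last exact: su.
  by rewrite msupport_dirac; [move=> _ ->|exact: metric_hausdorff].
rewrite -(setUIDK (histories G t) [set h]).
apply/measurable_funU; [exact: measurableI|exact: measurableD|split].
  apply: (eq_measurable_fun (cst (mdirac R a) : borel (hist G t) ->
    borel (Mspace R (Xs G t i)))); last exact: measurable_cst.
  by move=> h'; rewrite inE => -[_ /= ->]; rewrite eqxx.
apply: (eq_measurable_fun (@u i t : borel (hist G t) ->
  borel (Mspace R (Xs G t i)))).
  by move=> h'; rewrite inE => -[_ /= h'h]; case: eqP.
apply: measurable_funS mu => //; exact: subDsetl.
Qed.

Lemma is_profile_play_at (u : profile G) i t (h : hist G t) (a : Xs G t i) :
  is_profile u -> action G t i h a -> is_profile (play_at u h a).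
Proof. by move=> hu Aa; apply: is_profile_dfwith => //; exact: is_strategy_play_at. Qed.

Lemma singleton_moves (p : profile G) i t (h : hist G t) a : is_profile p ->
  histories G t h -> action G t i h = [set a] ->
  forall B : set (borel (Xs G t i)), measurable B ->
  @p i t h B = (\d_(a : borel (Xs G t i)) B)%R.
Proof.
move=> hp ht Aa; apply: msupport_sub1; first exact: separable_nat_based.
by rewrite -Aa; have [_] := hp i t; exact.
Qed.

Lemma singleton_same (p q : profile G) i t (h : hist G t) : is_profile p ->
  is_profile q -> histories G t h -> is_singleton (action G t i h) ->
  forall B : set (borel (Xs G t i)), measurable B -> @p i t h B = @q i t h B.
Proof.
move=> hp hq ht [a Aa] B mB.
exact: etrans (singleton_moves hp ht Aa mB) (esym (singleton_moves hq ht Aa mB)).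
Qed.

Lemma pure_action (g : pure_profile G) i t (h : hist G t) : is_pure_profile g ->
  histories G t h -> action G t i h (@g i t h).
Proof.
move=> hg ht; have [_ /(_ h ht)] := hg i t; apply.
by rewrite /mixed_of_pure msupport_dirac//; exact: metric_hausdorff.
Qed.

(* The unique moves of the other player and of Nature make the next history a
   function of the mover's action. *)
Lemma mover_next t (h : hist G t) i : histories G t h -> mover h i ->
  exists nxt : Xs G t i -> hist G t.+1,
  [/\ forall a, action G t i h a -> histories G t.+1 (nxt a),
      forall (p : profile G) j a, is_profile p -> action G t i h a ->
        (forall B : set (borel (Xs G t i)), measurable B ->
           @p i t h B = (\d_(a : borel (Xs G t i)) B)%R) ->
        payoff j p h = payoff j p (nxt a) &
      forall (p : profile G) j, is_profile p ->
        exists2 a, action G t i h a & payoff j p h <= payoff j p (nxt a)].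
Proof.
move=> ht mi; have [sA [s ns]] := single_player_moves hG ht mi.
(* For [j != i] this is the only available action; the value at [i] is overwritten in [x]. *)
pose b j : Xs G t j := get (action G t j h).
have Ab j : j != i -> action G t j h = [set b j].
  move=> /sA [a Aa]; have : action G t j h (b j).
    by apply: getPex; exists a; rewrite Aa.
  by rewrite Aa => ->.
pose x a : forall j, Xs G t j := dfwith b i a.
have xA a : action G t i h a -> forall j, action G t j h (x a j).
  move=> Aa j; rewrite /x; have [->|ji] := eqVneq j i; first by rewrite dfwithin.
  by rewrite dfwithout ?Ab// eq_sym.
exists (fun a => (h, (x a, s))); split.
- by move=> a Aa; split => //=; exact: xA.
- move=> p j a hp Aa pa; apply: (payoff_deterministic hG hp) => //; first exact: xA.
  move=> k; rewrite /x; have [->|ki] := eqVneq k i; first by rewrite dfwithin.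
  by rewrite dfwithout 1?eq_sym//; apply: singleton_moves => //; exact: Ab.
move=> p j hp.
have cs : closed [set s].
  by apply/accessible_closed_set1/hausdorff_accessible; exact: metric_hausdorff.
have ns1 : nature G t h [set s] = 1%E.
  by rewrite ns ?diracE ?mem_set//; exact: borel_closed cs.
(* Taking [C] to be [[set s]] fixes Nature's coordinate of the successor found, so its [i]-th action
   determines it. *)
have [h' [h'h h'A h's] le] := payoff_le_successor hG hp j ht (borel_closed cs) ns1.
exists (h'.2.1 i); first exact: h'A.
suff hE : h' = ((h, (x (h'.2.1 i), s)) : hist G t.+1).
  exact: le_eq2 erefl (congr1 (fun k : hist G t.+1 => payoff j p k) (esym hE)) le.
move: h' {le} h'h h'A h's => [h1 [y s1]] /= -> yA ->; congr (_, (_, _)).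
apply: functional_extensionality_dep => k; rewrite /x.
have [->|ki] := eqVneq k i; first by rewrite dfwithin.
by rewrite dfwithout 1?eq_sym//; have := yA k; rewrite Ab.
Qed.

End strategies.

Lemma sum_eq_le (R : realDomainType) (a b a' b' c : R) :
  a + b = c -> a' + b' = c -> b <= b' -> a' <= a.
Proof. by move=> <- e bb'; rewrite -(lerD2r b') e lerD2l. Qed.

(** * Values of equilibria in fixed-sum games *)

Section fixed_sum_games.
Context (R : realType) (G : game R 2).
Hypothesis hG : perfect_information_game G.
Hypothesis hsum : fixed_sum G.

Lemma payoff_other_le (p q : profile G) i t (h : hist G t) : is_profile p ->
  is_profile q -> histories G t h ->
  payoff (other i) p h <= payoff (other i) q h -> payoff i q h <= payoff i p h.
Proof.
move=> hp hq ht; have [c hc] := hsum.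
have sp := payoff_sum hG hp ht hc; have sq := payoff_sum hG hq ht hc.
have [->|->] := ord2P i.
  exact: (sum_eq_le sp sq).
exact: (sum_eq_le (etrans (addrC _ _) sp) (etrans (addrC _ _) sq)).
Qed.

Lemma payoff_eq_le (p q : profile G) t (h : hist G t) : is_profile p ->
  is_profile q -> histories G t h ->
  (forall i, payoff i p h <= payoff i q h) -> forall i, payoff i p h = payoff i q h.
Proof.
move=> hp hq ht le i; apply/le_anti/andP; split; first exact: le.
exact: payoff_other_le hp hq ht (le _).
Qed.

(** The two readings of the hybrid profile in the exchange argument: a deviation of the opponent
    from [p], or of [i] from [q]. *)
Lemma dfwith_other (p q : profile G) i :
  dfwith p (other i) (@q (other i)) = dfwith q i (@p i).
Proof.
apply: functional_extensionality_dep => j; have [->|ji] := eqVneq j i.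
  by rewrite dfwithin dfwithout// other_neq.
by rewrite (neq_other ji) dfwithin dfwithout// eq_sym other_neq.
Qed.

Lemma dfwith_id (p : profile G) i : dfwith p i (@p i) = p.
Proof.
apply: functional_extensionality_dep => j; have [->|ji] := eqVneq j i.
  by rewrite dfwithin.
by rewrite dfwithout// eq_sym.
Qed.

Lemma dfwith_neq (p : profile G) i t (m : hist G t -> Mspace R (Xs G t i)) k l :
  k != t ->
  dfwith p i (dfwith (@p i) t m : strategy G i) l k = @p l k.
Proof.
move=> kt; have [->|li] := eqVneq l i; first by rewrite dfwithin dfwithout// eq_sym.
by rewrite dfwithout// eq_sym.
Qed.

Lemma later_payoff_play_at (p : profile G) i j t (h : hist G t) a (h' : hist G t.+1) :
  histories G t.+1 h' -> payoff j (@play_at R 2 G p t h i a) h' = payoff j p h'.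
Proof.
move=> h't; apply: payoff_same_moves => // k h2 tk _ l B mB.
by rewrite /play_at dfwith_neq// gtn_eqF.
Qed.

Lemma play_at_self (p : profile G) i t (h : hist G t) a :
  @play_at R 2 G p t h i a i t h = mdirac R a.
Proof. by rewrite /play_at !dfwithin eqxx. Qed.

Variable f : profile G.
Hypotheses (hf : is_spe f) (hbi : improved_backward_induction f).

Let pf : is_profile f := hf.1.

Lemma pure_spe_realization (g : pure_profile G) : is_pure_spe g -> is_realization f g.
Proof.
move=> [hg [pg sg]]; split=> // i t h ht.
(* The exchange argument, with the hybrid of [f] and [g] as middle term. *)
have val : forall k (h' : hist G k), histories G k h' ->
    forall j, payoff j f h' = payoff j (mixed_of_pure g) h'.
  move=> k h' h't; apply: (payoff_eq_le pf pg h't) => j.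
  have pfj : is_profile (dfwith f (other j) (mixed_of_pure g (other j))).
    by apply: is_profile_dfwith => //; exact: pg.
  apply: (@le_trans _ _ (payoff j (dfwith f (other j) (mixed_of_pure g (other j))) h')).
    apply: (payoff_other_le pfj pf h't).
    exact: (hf.2 (other j) k h' h't _ (pg (other j))).
  rewrite dfwith_other; exact: (sg j k h' h't _ (pf j)).
have [[a Aa]|mi] := pselect (is_singleton (action G t i h)).
  have [_ /(_ h ht)] := pf i t; rewrite Aa => sub.
  have [y ys] := msupport_neq0 (@f i t h) (separable_nat_based _).
  have := pure_action i hg ht; rewrite Aa => ->.
  by rewrite -(sub _ ys).
have Ag := pure_action i hg ht.
have [nxt [nxtH nxtE _]] := mover_next hG ht mi.
have nH := nxtH _ Ag.
rewrite (hbi ht mi).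
split; first exact: Ag.
move=> b Ab.
(* Playing [b] once is a deviation from [f], hence bounded by the value at [h]. The rest shows that
   [g i t h] attains this value: it leads to a successor where [f] and [g] have equal payoffs. *)
apply: (@le_trans _ _ (payoff i f h)).
  exact: (hf.2 i t h ht _ (is_strategy_play_at hG pf Ab)).
have pp := is_profile_play_at hG pf Ag.
have E1 : payoff i (@play_at R 2 G f t h i (@g i t h)) h = payoff i f (nxt (@g i t h)).
  apply: etrans (nxtE _ i _ pp Ag _) _; last first.
    exact: (@later_payoff_play_at f i i t h (@g i t h) _ nH).
  by move=> B mB; rewrite play_at_self.
have E2 : payoff i (mixed_of_pure g) h = payoff i (mixed_of_pure g) (nxt (@g i t h)).
  by apply: (nxtE _ i _ pg Ag) => B mB.
rewrite E1 (val _ _ nH) -E2 -(val _ _ ht); exact: lexx.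
Qed.

Variable T : nat.
Hypothesis hT : forall t i (h : hist G t), (T <= t)%N -> histories G t h ->
  is_singleton (action G t i h).

(* In the inductive step, [N] plays the moves of [Q] at the current stage and
   follows [f] afterwards. *)
Lemma realization_deviation (g : pure_profile G) i (fi' : strategy G i) :
  is_realization f g -> is_strategy fi' -> forall t (h : hist G t), histories G t h ->
  payoff i (dfwith (mixed_of_pure g) i fi') h <= payoff i f h.
Proof.
move=> [pg sg] sfi'; set Q := dfwith _ _ _ => t h ht.
have pQ : is_profile Q by exact: is_profile_dfwith.
have [d Td] : exists d, (T <= t + d)%N by exists T; exact: leq_addl.
(* [d] bounds the number of stages left before the horizon. In the base case only Nature can still
   have a choice, so [Q] and [f] make the same moves forever. *)
elim: d t h ht Td => [|d IH] t h ht Td.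
  rewrite addn0 in Td; apply: le_eq2 (payoff_same_moves i ht _) erefl (lexx _).
  move=> k h' tk h't j B mB; apply: (singleton_same pQ pf h't) => //.
  by apply: hT => //; exact: leq_trans tk.
pose N : profile G := fun j => dfwith (@f j) t (@Q j t) : strategy G j.
have pN : is_profile N by exact: is_profile_stage.
have QN : same_moves Q N h by move=> j B mB; rewrite /N dfwithin.
have later j (h' : hist G t.+1) : histories G t.+1 h' ->
    payoff j N h' = payoff j f h'.
  move=> h't; apply: (payoff_same_moves j h't) => k h2 tk _ l B mB.
  by rewrite /N dfwithout// eq_sym gtn_eqF.
apply: (@le_trans _ _ (payoff i N h)).
  apply: (payoff_le_same_moves hG pQ pN ht QN) => h' /(successors_histories ht) h't.
  apply: le_eq2 erefl (later i h' h't) _; apply: IH => //.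
  by rewrite addSnnS.
have Qj : @Q (other i) = mixed_of_pure g (other i).
  by rewrite /Q dfwithout// eq_sym other_neq.
have Qi : @Q i = fi' by rewrite /Q dfwithin.
(* If the opponent has no choice at [h], whether [i], Nature or nobody moves, then [N] has the
   payoff of the deviation [ui] from [f] at stage [t] alone, and the equilibrium property of [f]
   bounds it. *)
have [sj|mj] := pselect (is_singleton (action G t (other i) h)).
  pose ui : strategy G i := dfwith (@f i) t (fi' t).
  have sui : is_strategy ui by apply: is_strategy_dfwith; [exact: pf|exact: sfi'].
  have pu : is_profile (dfwith f i ui) by exact: is_profile_dfwith.
  apply: le_trans (hf.2 i t h ht ui sui).
  apply: le_eq2 (payoff_same_moves_step hG pN pu ht _ _) erefl (lexx _).
    move=> j; have [->|/neq_other ->] := eqVneq j i; move=> B mB.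
      by rewrite /N dfwithin dfwithin /ui dfwithin Qi.
    exact: (singleton_same pN pu ht sj mB).
  move=> h' /(successors_histories ht) h't; apply: etrans (later i h' h't) _.
  apply: esym; apply: (payoff_same_moves i h't) => k h2 tk _ l B mB.
  by rewrite /ui dfwith_neq// gtn_eqF.
have Ag := pure_action (other i) pg ht.
have si : is_singleton (action G t i h).
  have [sm _] := single_player_moves hG ht mj.
  by apply: sm; rewrite eq_sym other_neq.
have [nxt [nxtH nxtE nxtle]] := mover_next hG ht mj.
have := sg (other i) t h ht; rewrite (hbi ht mj) => -[_ opt].
set b := @g (other i) t h in Ag opt *.
have pb := is_profile_play_at hG pf Ag.
have [a Aa le] := nxtle f (other i) pf.
have pa := is_profile_play_at hG pf Aa.
(* Some action [a] of the opponent does at least as well as his mixed action in [f], and the optimal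
   [b] does at least as well as [a]. What he gains, [i] loses. *)
have fb : payoff (other i) f h <= payoff (other i) (@play_at R 2 G f t h (other i) b) h.
  apply: le_trans (opt a Aa); apply: le_trans le _.
  apply: le_eq2 erefl _ (lexx _).
  apply: etrans (nxtE _ (other i) _ pa Aa _) _; last first.
    exact: (@later_payoff_play_at f (other i) (other i) t h a _ (nxtH _ Aa)).
  by move=> B mB; rewrite play_at_self.
apply: le_trans (payoff_other_le pf pb ht fb).
(* [N] and [play_at f h b] may differ at other histories of stage [t], but play from [h] never meets
   these. *)
apply: le_eq2 (payoff_same_moves_step hG pN pb ht _ _) erefl (lexx _).
  move=> j; have [->|/neq_other ->] := eqVneq j i; move=> B mB.
    exact: (singleton_same pN pb ht si mB).
  by rewrite play_at_self /N dfwithin Qj.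
move=> h' /(successors_histories ht) h't.
apply: etrans (later i h' h't) _; apply: esym.
exact: (@later_payoff_play_at f (other i) i t h b h' h't).
Qed.

Lemma realization_pure_spe (g : pure_profile G) : is_realization f g -> is_pure_spe g.
Proof.
move=> rg; have [pg _] := rg; split; first exact: pg.
split; first exact: pg.
move=> i t h ht fi' sfi'.
(* The trivial deviation of each player to his own strategy in [g] bounds both payoffs of [g] by
   those of [f]. With a constant sum they coincide, so the bound on deviations from [g] is in terms
   of the payoff of [g] itself. *)
have P_f j : payoff j (mixed_of_pure g) h <= payoff j f h.
  have := realization_deviation rg (pg j) ht; by rewrite dfwith_id.
apply: le_eq2 erefl (payoff_eq_le pg pf ht P_f i) _.
exact: (realization_deviation rg sfi' ht).
Qed.

End fixed_sum_games.

Theorem proposition2 (R : realType) (G : game R 2)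
    (hG : perfect_information_game G) (hfin : finite_horizon G)
    (hsum : fixed_sum G) (f : profile G) (hf : is_spe f)
    (hbi : improved_backward_induction f) :
  [set g : pure_profile G | is_realization f g] =
  [set g : pure_profile G | is_pure_spe g].
Proof.
have [T hT] := hfin; apply/seteqP; split=> g /=.
  exact: (realization_pure_spe hG hsum hf hbi hT).
exact: (pure_spe_realization hG hsum hf hbi).
Qed.
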